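(* There exist numerical constants $C>0$ (sufficiently large) and $c>0$ such that the following holds. Let $\mathbf A$ be the $N\times N$ adjacency matrix of a graph under the generalized stochastic block model (GSBM) with $n$ inliers, $m$ outliers, $r$ communities, and parameters $p^-,q^+,\delta=p^--q^+>0,n_{\min}$ (see context). Let $\alpha,\lambda$ be real tuning parameters satisfying $\alpha\ge3m$ and $q^++\frac\delta4<\lambda<p^--\frac\delta4$, and suppose $p^-\ge C\frac{\log n}{n_{\min}}$ and $$\delta>C\left(\sqrt{\frac{p^-\log n}{n_{\min}}}+\frac{\alpha}{n_{\min}}+\frac{\sqrt{nq^+\log n}}{n_{\min}}+\frac{m\sqrt r}{n_{\min}}+\frac{nmp^-}{(\alpha-2m)n_{\min}}\right).$$ Suppose in addition that $m<\frac{n_{\min}}{2r+4}$. Let $\widehat{\mathbf X}$ be a solution to $$\min_{\widetilde{\mathbf X}}\ \langle \widetilde{\mathbf X},\mathbf E\rangle\quad\text{subject to}\quad \widetilde{\mathbf X}\succeq \mathbf 0,\quad 0\le \widetilde X_{ij}\le 1\ \ (1\le i,j\le N),$$ with $\mathbf E=\alpha\mathbf I_N-(1-\lambda)\mathbf A+\lambda(\mathbf J_N-\mathbf I_N-\mathbf A)$, and let $\widehat S_1,\dots,\widehat S_r$ be an (exact) $k$-means solution with $k=r$ for the normalized columns of $\widehat{\mathbf X}$. Then, with high probability, namely with probability at least $1-\frac1n-\frac{2r}{n^2}-\frac{cr}{n_{\min}^4}$, the misclassification rate among the inlier nodes is less than or equal to $\frac{(2r+3)m}{n}$.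
   Context: Notation: $\mathbf I_\ell$ is the $\ell\times\ell$ identity, $\mathbf J_\ell$ the $\ell\times\ell$ all-ones matrix, $\langle\mathbf M_1,\mathbf M_2\rangle$ the trace inner product, $\mathbf M\succeq\mathbf 0$ means symmetric positive semidefinite. GSBM: $N=n+m$ nodes, of which $n$ are inliers and $m$ are outliers. The inliers are divided into $r\ge2$ communities of sizes $l_1,\dots,l_r\ge1$, $n=\sum_{i=1}^r l_i$. The adjacency matrix is $$\mathbf A=\mathbf P\begin{bmatrix}\mathbf K&\mathbf Z\\ \mathbf Z^\top&\mathbf W\end{bmatrix}\mathbf P^\top,$$ where $\mathbf P$ is an unknown fixed $N\times N$ permutation matrix; $\mathbf K$ is a random symmetric $n\times n$ $0$-$1$ matrix with zero diagonal, partitioned into blocks $\mathbf K_{ij}$ of size $l_i\times l_j$, whose entries strictly above the diagonal are independent Bernoulli variables, with parameter $B_{ij}$ for an entry lying in block $\mathbf K_{ij}$; $\mathbf B=(B_{ij})$ is a symmetric $r\times r$ matrix with entries in $[0,1]$; $\mathbf Z$ is an arbitrary $n\times m$ $0$-$1$ matrix and $\mathbf W$ an arbitrary symmetric $m\times m$ $0$-$1$ matrix with zero diagonal. $\mathbf Z$ and $\mathbf W$ are allowed to be random and to depend on $\mathbf K$ in an arbitrary way. The labeling function $\phi$ assigns to node $u\in\{1,\dots,N\}$ the value $k\in\{1,\dots,r\}$ if the index $s$ with $P_{us}=1$ lies in the $k$th block of $\{1,\dots,n\}$ (of size $l_k$), in which case $u$ is an inlier of community $k$, and the value $r+1$ if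 $s>n$, in which case $u$ is an outlier. Parameters: $p^-=\min_{1\le i\le r}B_{ii}$, $q^+=\max_{1\le i<j\le r}B_{ij}$, $\delta=p^--q^+$ (assumed $>0$), $n_{\min}=\min_{1\le i\le r}l_i$. When $m=0$, the term $\frac{nmp^-}{(\alpha-2m)n_{\min}}$ is read as $0$ (even if $\alpha=0$). $k$-means step: let $\mathbf x_1,\dots,\mathbf x_N$ be the columns of $\widehat{\mathbf X}$ and $\mathbf y_i=\mathbf x_i/\|\mathbf x_i\|_2$ (if $\mathbf x_i=\mathbf 0$, $\mathbf y_i$ is an arbitrary nonnegative unit vector). $(\widehat S_1,\dots,\widehat S_r)$ is the partition component of a global minimizer, over all partitions $(S_1,\dots,S_r)$ of $\{1,\dots,N\}$ and all centers $\boldsymbol\mu_1,\dots,\boldsymbol\mu_r\in\mathbb R^N$, of $$\sum_{k=1}^r\sum_{j\in S_k}\|\mathbf y_j-\boldsymbol\mu_k\|_2^2 .$$ Write $\hat\phi(j)=k$ for $j\in\widehat S_k$. Misclassification rate among the inliers: the maximum of $p/n$ over all integers $p\ge0$ for which there exist $p$ pairs of nodes $(a_1,b_1),\dots,(a_p,b_p)$, with all $2p$ indices distinct, such that $1\le\phi(a_j)<\phi(b_j)\le r$ and $\hat\phi(a_j)=\hat\phi(b_j)$ for all $j=1,\dots,p$. *)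

(* Defs.v *)
From HB Require Import structures.
From mathcomp Require Import all_boot all_order all_algebra all_fingroup.
From mathcomp Require Import all_classical all_reals all_analysis.

Set Implicit Arguments.
Unset Strict Implicit.
Unset Printing Implicit Defensive.

Import Order.TTheory GRing.Theory Num.Theory.
Local Open Scope classical_set_scope.
Local Open Scope ring_scope.

(* The n inliers are indexed by 'I_(\sum_(i < r) l i), split into consecutive
   blocks of sizes l 0, ..., l (r - 1) as in \mxblock; tagnat.sig1 s is the
   block containing s.  All indices and labels are 0-based. *)

Section GSBM.
Context (R : realType) d (T : measurableType d) (P : probability T R).

(* Mutual independence of a finite family of random variables; any
   measurable d' T' is allowed, bool carries the discrete sigma-algebra. *)
Definition mutually_independent d' (T' : measurableType d') (I : finType)
    (X : I -> T -> T') : Prop :=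
  forall (J : {set I}) (S : I -> set T'), (forall i, measurable (S i)) ->
  P [set w | forall i, i \in J -> S i (X i w)] =
  (\prod_(i in J) P (X i @^-1` S i))%E.

Definition random_boolmx p q (M : T -> 'M[bool]_(p, q)) : Prop :=
  forall i j, measurable_fun [set: T] (fun w => M w i j).

(* A random Boolean matrix has finitely many values, so that every event that
   depends only on its value is measurable. *)
Lemma measurable_boolmx p q (M : T -> 'M[bool]_(p, q))
    (Q : set 'M[bool]_(p, q)) :
  random_boolmx M -> measurable [set w | Q (M w)].
Proof.
move=> mM.
have -> : [set w | Q (M w)] =
    \bigcup_(B in Q) \bigcap_(u in [set: 'I_p * 'I_q])
      ((fun w => M w u.1 u.2) @^-1` [set B u.1 u.2]).
  apply/seteqP; split => [w QMw|w [B QB] wB]; first by exists (M w).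
  rewrite /=; suff -> : M w = B by [].
  by apply/matrixP => i j; exact: (wB (i, j)).
apply: fin_bigcup_measurable => [|B _]; first exact: finite_finset.
apply: fin_bigcap_measurable => [|u _]; first exact: finite_finset.
by rewrite -[X in measurable X]setTI; exact: mM.
Qed.

(* K, Z, W are the blocks of the unpermuted adjacency matrix; nothing links
   the (random) Z and W to K. *)
Record gsbm (r m : nat) (l : 'I_r -> nat) (B : 'M[R]_r)
    (K : T -> 'M[bool]_(\sum_(i < r) l i))
    (Z : T -> 'M[bool]_(\sum_(i < r) l i, m))
    (W : T -> 'M[bool]_m) : Prop := {
  gsbm_r : (2 <= r)%N ;
  gsbm_l : forall i, (1 <= l i)%N ;
  gsbm_Bsym : B^T = B ;
  gsbm_B01 : forall i j, 0 <= B i j <= 1 ;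
  gsbm_Krandom : random_boolmx K ;
  gsbm_Zrandom : random_boolmx Z ;
  gsbm_Wrandom : random_boolmx W ;
  gsbm_Ksym : forall w, (K w)^T = K w ;
  gsbm_Kdiag : forall w i, K w i i = false ;
  gsbm_Wsym : forall w, (W w)^T = W w ;
  gsbm_Wdiag : forall w i, W w i i = false ;
  gsbm_Kbernoulli : forall i j : 'I_(\sum_(i < r) l i), (i < j)%N ->
    P [set w | K w i j = true] = (B (tagnat.sig1 i) (tagnat.sig1 j))%:E ;
  gsbm_Kindep : mutually_independent
    (fun (e : {e : 'I_(\sum_(i < r) l i) * 'I_(\sum_(i < r) l i)
                 | (e.1 < e.2)%N}) w => K w (val e).1 (val e).2)
}.

End GSBM.

Section Model.
Context (R : realType).

(* perm_mx s u t = 1 iff s u = t. *)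
Definition gsbm_adjacency n m (s : 'S_(n + m)) (K : 'M[bool]_n)
    (Z : 'M[bool]_(n, m)) (W : 'M[bool]_m) : 'M[R]_(n + m) :=
  perm_mx s *m map_mx (fun b : bool => b%:R) (block_mx K Z Z^T W)
    *m (perm_mx s)^T.

(* Labels 0, ..., r - 1 are the communities and label r marks the outliers. *)
Definition gsbm_label r m (l : 'I_r -> nat)
    (s : 'S_((\sum_(i < r) l i) + m)) (u : 'I_((\sum_(i < r) l i) + m)) : nat :=
  match fintype.split (s u) with
  | inl i => tagnat.sig1 i
  | inr _ => r
  end.

(* The default values of the three iterated min/max are harmless: r >= 2, the
   entries of B lie in [0, 1], and each l i is at most their sum. *)
Definition pminus r (B : 'M[R]_r) : R := \big[Num.min/1]_(i < r) B i i.

Definition qplus r (B : 'M[R]_r) : R :=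
  \big[Num.max/0]_(p : 'I_r * 'I_r | (p.1 < p.2)%N) B p.1 p.2.

Definition nmin r (l : 'I_r -> nat) : nat :=
  \big[minn/(\sum_(i < r) l i)%N]_(i < r) l i.

Definition psd N (X : 'M[R]_N) : Prop :=
  X^T = X /\ forall v : 'cV[R]_N, 0 <= (v^T *m X *m v) 0 0.

Definition sdp_cost N (alpha lambda : R) (A : 'M[R]_N) : 'M[R]_N :=
  alpha%:M - (1 - lambda) *: A + lambda *: (const_mx 1 - 1%:M - A).

Definition sdp_feasible N (X : 'M[R]_N) : Prop :=
  psd X /\ forall i j, 0 <= X i j <= 1.

Definition sdp_solution N (E X : 'M[R]_N) : Prop :=
  sdp_feasible X /\
  forall X', sdp_feasible X' -> \tr (X^T *m E) <= \tr (X'^T *m E).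

(* Euclidean norm; the library norm `|x| on matrices is the sup norm. *)
Definition norm2 N (x : 'cV[R]_N) : R := Num.sqrt (\sum_i x i 0 ^+ 2).

Definition normalized_columns N (X : 'M[R]_N) (y : 'I_N -> 'cV[R]_N) : Prop :=
  forall i, if col i X != 0 then y i = (norm2 (col i X))^-1 *: col i X
            else norm2 (y i) = 1 /\ forall k, 0 <= y i k 0.

(* A partition (S_1, ..., S_r) is given by its labeling f, S_k being the fiber
   of f over k; fibers may be empty. *)
Definition kmeans_cost N r (y : 'I_N -> 'cV[R]_N)
    (f : 'I_N -> 'I_r) (mu : 'I_r -> 'cV[R]_N) : R :=
  \sum_(k < r) \sum_(j | f j == k) norm2 (y j - mu k) ^+ 2.

Definition kmeans_solution N r (y : 'I_N -> 'cV[R]_N) (f : 'I_N -> 'I_r) :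
    Prop :=
  exists mu, forall (f' : 'I_N -> 'I_r) mu',
    kmeans_cost y f mu <= kmeans_cost y f' mu'.

(* p pairwise disjoint pairs of inliers from distinct communities that f puts
   in the same cluster. *)
Definition misclassified_pairs N r (phi : 'I_N -> nat) (f : 'I_N -> 'I_r)
    (p : nat) : bool :=
  [exists a : p.-tuple 'I_N, [exists b : p.-tuple 'I_N,
    uniq (a ++ b) &&
    [forall j : 'I_p, [&& (phi (tnth a j) < phi (tnth b j))%N,
                          (phi (tnth b j) < r)%N
                        & f (tnth a j) == f (tnth b j)]]]].

(* Disjointness forces 2p <= N, so bounding p by N loses nothing. *)
Definition misclassification_rate N r (n : nat) (phi : 'I_N -> nat)
    (f : 'I_N -> 'I_r) : R :=
  (\max_(p < N.+1 | misclassified_pairs phi f p) p)%:R / n%:R.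

End Model.

(* Main.v *)
Require Import Defs.
From HB Require Import structures.
From mathcomp Require Import all_boot all_order all_algebra all_fingroup.
From mathcomp Require Import all_classical all_reals all_analysis.
From mathcomp Require Import ring lra zify.

(* Write [S_k] for the communities and compare a solution [X] with the Gram
   matrix [X'] in which all inliers of [S_k] share the k-th unit vector and the
   outliers have the nonnegative coordinates [Z] that are optimal given those
   vectors.  The optimality system of [Z] provides the part of a dual
   certificate [S] that involves the outliers; its Schur complement [H] changes
   the inlier block only by a matrix with small block row sums.  Subtracting
   block row and column means from the inlier block makes [S] annihilate [X'],
   and the price paid in every entry is a row-sum fluctuation of the noise, while
   [S] is positive semidefinite as soon as the noise has small spectral norm.
   Hence the inlier block of [X] is exactly the block-diagonal 0-1 matrix.

   The noise is controlled by a Chernoff bound for the row sums and by the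
   moments [E tr W^(2k)] with [k] of order [ln n] for the spectral norm.

   Consequently all inliers of a community have the same normalized column, and
   the columns of two communities are almost orthogonal.  Putting the centers on
   these columns costs at most [2 m], whereas every misclassified pair costs at
   least [1 - m / n_min]. *)

Set Implicit Arguments.
Unset Strict Implicit.
Unset Printing Implicit Defensive.

Import Order.TTheory GRing.Theory Num.Theory.
Local Open Scope ring_scope.

(** * Moments of Bernoulli noise matrices *)

(** The outlier entries may depend on the inlier graph, so no estimate may average over them. The
    only random event concerns the inlier noise; on it, the certificate is built for every choice of
    outlier entries.

    The obstacle is an outlier with many inlier neighbours, which could make the Schur complement
    large. It is tamed by its own multiplier: nonnegativity of the slack bounds the degree of
    outlier [j] by [a0 + (alpha + mu 0 j) * sqrt r], while the outlier block dominates
    [alpha - m + mu 0 j] in that coordinate. The ratio of the two is bounded however large the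
    degree is.

    Inside a community the gap [B k k - lambda] has two uses: one half becomes a Laplacian that
    dominates the noise on block-centered vectors, the other keeps the entries of the multiplier
    positive.

    A crude count of walks suffices for the spectral norm: it loses a factor of order [sqrt (ln n)],
    which the logarithms in the separation hypothesis already pay for. *)

Section BernoulliProduct.
Context (R : realFieldType) (E : finType) (pr : E -> R).

Definition bern_weight (t : R) (b : bool) : R := if b then t else 1 - t.

(** A finite weighted sum rather than an integral, so that moments are pure algebra;
    [probability_bits_le] is the bridge to the measure [P]. *)
Definition bern_expect (f : {ffun E -> bool} -> R) : R :=
  \sum_(b : {ffun E -> bool}) (\prod_e bern_weight (pr e) (b e)) * f b.

Lemma bern_expect_prod (g : E -> bool -> R) :
  bern_expect (fun b => \prod_e g e (b e)) =
  \prod_e (pr e * g e true + (1 - pr e) * g e false).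
Proof.
rewrite /bern_expect.
transitivity (\sum_(b : {ffun E -> bool}) \prod_e (bern_weight (pr e) (b e) * g e (b e))).
  by apply: eq_bigr => b _; rewrite big_split.
rewrite -(bigA_distr_bigA (fun e b => bern_weight (pr e) b * g e b)).
by apply: eq_bigr => e _; rewrite big_bool.
Qed.

Lemma bern_expect_sum (I : Type) (r : seq I) (Q : pred I) (F : I -> {ffun E -> bool} -> R) :
  bern_expect (fun b => \sum_(i <- r | Q i) F i b) = \sum_(i <- r | Q i) bern_expect (F i).
Proof.
rewrite /bern_expect exchange_big /=; apply: eq_bigr => b _.
by rewrite mulr_sumr.
Qed.

Lemma eq_bern_expect (f g : {ffun E -> bool} -> R) : f =1 g ->
  bern_expect f = bern_expect g.
Proof. by move=> fg; apply: eq_bigr => b _; rewrite fg. Qed.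

Lemma bern_expectZ k (f : {ffun E -> bool} -> R) :
  bern_expect (fun b => k * f b) = k * bern_expect f.
Proof. by rewrite /bern_expect mulr_sumr; apply: eq_bigr => b _; ring. Qed.

Lemma bern_expectD (f g : {ffun E -> bool} -> R) :
  bern_expect (fun b => f b + g b) = bern_expect f + bern_expect g.
Proof. by rewrite /bern_expect -big_split; apply: eq_bigr => b _ /=; ring. Qed.

Hypothesis pr01 : forall e, 0 <= pr e <= 1.

Lemma bern_weight_ge0 e b : 0 <= bern_weight (pr e) b.
Proof. by have := pr01 e; case: b => /=; lra. Qed.

Lemma ler_bern_expect (f g : {ffun E -> bool} -> R) :
  (forall b, f b <= g b) -> bern_expect f <= bern_expect g.
Proof.
move=> fg; apply: ler_sum => b _; apply: ler_wpM2l => //.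
by apply: prodr_ge0 => e _; exact: bern_weight_ge0.
Qed.

(** The mask [c] lets one family of centered variables serve for single row sums, diagonal blocks
    and the off-diagonal part. *)
Definition noise (c : pred E) (e : E) (b : bool) : R := (c e)%:R * (b%:R - pr e).

Lemma noise_moment (c : pred E) e m :
  `|pr e * noise c e true ^+ m + (1 - pr e) * noise c e false ^+ m| <=
  if m is 0 then 1 else if m is 1 then 0 else (c e)%:R * pr e.
Proof.
have /andP[p0 p1] := pr01 e; case: m => [|[|m]].
- by rewrite !expr0 ger0_norm; lra.
- by rewrite !expr1 /noise /= [X in `|X|](_ : _ = 0) ?normr0 //; ring.
case ce : (c e); last first.
  have z b : noise c e b = 0 by rewrite /noise ce mulr0n mul0r.
  by rewrite !z !expr0n !mulr0 addr0 normr0 mul0r.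
have -> : noise c e true = 1 - pr e by rewrite /noise ce !mulr1n mul1r.
have -> : noise c e false = - pr e by rewrite /noise ce mulr1n mulr0n mul1r sub0r.
rewrite mul1r; have p0' : 0 <= 1 - pr e by lra.
apply: (le_trans (ler_normD _ _)).
rewrite (normrM (pr e)) normrX (normrM (1 - pr e)) normrX normrN.
rewrite (ger0_norm p0) (ger0_norm p0').
have H1 : (1 - pr e) ^+ m.+2 <= 1 - pr e.
  by rewrite exprS ler_piMr // exprn_ile1 //; lra.
have H2 : pr e ^+ m.+2 <= pr e by rewrite exprS ler_piMr // exprn_ile1 //.
have H3 : (1 - pr e) * pr e ^+ m.+2 <= (1 - pr e) * pr e ^+ 2.
  apply: ler_wpM2l => //; rewrite !exprS; apply: ler_wpM2l => //.
  by rewrite mulr1 ler_piMr // exprn_ile1.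
(* For p = [pr e] this middle term is p - p^3, hence at most p. *)
apply: (@le_trans _ _ (pr e * (1 - pr e) + (1 - pr e) * pr e ^+ 2)).
  by apply: lerD => //; apply: ler_wpM2l.
nra.
Qed.

Lemma size_undup_count (T : eqType) (s : seq T) :
  (size s = \sum_(x <- undup s) count_mem x s)%N.
Proof.
rewrite -(sum1_size s) -(@big_undup_iterop_count _ 0%N addn _ s xpredT (fun=> 1%N)).
by apply: eq_bigr => x _; rewrite Monoid.iteropE iter_addn mul1n addn0.
Qed.

Lemma perm_filter_undup (T : finType) (s : seq T) :
  perm_eq [seq x <- index_enum T | x \in s] (undup s).
Proof.
apply: uniq_perm; rewrite ?undup_uniq ?filter_uniq ?index_enum_uniq // => x.
by rewrite mem_undup mem_filter mem_index_enum andbT.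
Qed.

(* A variable occurring exactly once kills the expectation, so at most half of
   the factors of a surviving product are distinct. *)
Lemma norm_bern_expect_prod_noise (c : pred E) (v : E -> R) (y : R) (k : nat) (H : seq E) :
  (forall e, c e -> pr e <= v e) -> (forall e, 0 <= v e) ->
  0 < y <= 1 -> size H = k.*2 ->
  `|bern_expect (fun b => \prod_(e <- H) noise c e (b e))| <=
  y ^- k * \prod_(e <- undup H) (y * v e).
Proof.
move=> cv v0 /andP[y0 y1] szH.
have -> : bern_expect (fun b => \prod_(e <- H) noise c e (b e)) =
    \prod_e (pr e * noise c e true ^+ count_mem e H
             + (1 - pr e) * noise c e false ^+ count_mem e H).
  rewrite -(bern_expect_prod (fun e b => noise c e b ^+ count_mem e H)).
  apply: eq_bern_expect => b;
    rewrite -(prodr_undup_exp_count H xpredT (fun e => noise c e (b e))).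
  rewrite [RHS](bigID (fun e => e \in H)) /= [X in _ * X]big1 ?mulr1.
    by rewrite -[RHS]big_filter (perm_big _ (perm_filter_undup H)).
  by move=> e; rewrite -has_pred1 has_count -leqNgt leqn0 => /eqP ->; rewrite expr0.
rewrite normr_prod.
have RHS0 : 0 <= y ^- k * \prod_(e <- undup H) (y * v e).
  rewrite mulr_ge0 ?invr_ge0 ?exprn_ge0 ?(ltW y0) //.
  by rewrite big_seq prodr_ge0 // => e _; rewrite mulr_ge0 // ltW.
have [/hasP[e eH /eqP ce]|/hasPn noone] := boolP (has (fun e => count_mem e H == 1%N) H).
  rewrite (bigD1 e) //= ce.
  have := noise_moment c e 1; rewrite normr_le0 => /eqP ->.
  by rewrite normr0 mul0r.
apply: (@le_trans _ _ (\prod_(e <- undup H) v e)).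
  rewrite (bigID (fun e => e \in H)) /= mulrC -[leRHS]mul1r; apply: ler_pM.
  - exact: prodr_ge0.
  - exact: prodr_ge0.
  - apply: prodr_ile1 => e;
    rewrite normr_ge0 /= -has_pred1 has_count -leqNgt leqn0 => /eqP ->.
    exact: (noise_moment c e 0).
  - rewrite -big_filter (perm_big _ (perm_filter_undup H)) /=.
    rewrite big_seq [leRHS]big_seq; apply: ler_prod => e; rewrite mem_undup => eH.
    rewrite normr_ge0 /=; apply: (le_trans (noise_moment c e _)).
    have := noone _ eH; have : (0 < count_mem e H)%N by rewrite -has_count has_pred1.
    case: (count_mem e H) => [|[|q]] // _ _.
    by case ec : (c e); rewrite ?mul0r ?mul1r //=; apply: cv.
(* At most [k] factors are distinct and [y <= 1], so [y ^- k] compensates one factor [y] per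
   distinct edge. The free parameter [y] is tuned in the trace bound. *)
rewrite big_split /= big_const_seq count_predT mulrA -[leLHS]mul1r.
apply: ler_wpM2r; first by rewrite big_seq prodr_ge0.
rewrite -Monoid.iteropE -/(y ^+ _) ler_pdivlMl ?exprn_gt0 // mulr1.
apply: ler_wiXn2l; rewrite ?(ltW y0) //.
rewrite -leq_double -szH [leqRHS]size_undup_count -mul2n mulnC -sum1_size big_distrl /=.
rewrite big_seq [leqRHS]big_seq; apply: leq_sum => e; rewrite mem_undup => eH.
have := noone _ eH; have : (0 < count_mem e H)%N by rewrite -has_count has_pred1.
by rewrite mul1n; case: (count_mem e H) => [|[|q]].
Qed.

(** * Trace moments of symmetric noise matrices *)

Section Matrix.
Variables (c : pred E) (n : nat) (ed : 'I_n -> 'I_n -> option E).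
Hypothesis ed_inj : forall i j j' e, ed i j = Some e -> ed i j' = Some e -> j = j'.

(** [ed i j] names the variable in position (i, j); [None] stands for a deterministic zero. Both
    positions of a symmetric matrix can thus share one variable. *)
Definition noise_mx (b : {ffun E -> bool}) : 'M[R]_n :=
  \matrix_(i, j) oapp (fun e => noise c e (b e)) 0 (ed i j).

Variables (v : E -> R) (a : R) (k : nat).
Hypotheses (cv : forall e, c e -> pr e <= v e) (v0 : forall e, 0 <= v e).
Hypothesis va : forall i, \sum_j oapp v 0 (ed i j) <= a.

(* Expanding the matrix power one step at a time: a step along an edge that was
   already used is one of at most [size H] possibilities, and a step along a new
   edge contributes its variance. *)
Lemma norm_bern_expect_walk (y : R) t (H : seq E) i j :
  0 < y <= 1 -> (size H + t = k.*2)%N ->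
  `|bern_expect (fun b => \prod_(e <- H) noise c e (b e) * (noise_mx b ^+ t) i j)| <=
  y ^- k * \prod_(e <- undup H) (y * v e) * (y * a + k.*2%:R) ^+ t.
Proof.
move=> y01; have /andP[y0 y1] := y01.
have a0 : 0 <= a.
  by apply: (le_trans _ (va i)); apply: sumr_ge0 => q _; case: (ed i q) => //=.
have P0 (s : seq E) : 0 <= y ^- k * \prod_(e <- s) (y * v e).
  rewrite mulr_ge0 ?invr_ge0 ?exprn_ge0 ?(ltW y0) //.
  by rewrite big_seq prodr_ge0 // => e _; rewrite mulr_ge0 // ltW.
elim: t H i => [|t IH] H i.
  rewrite addn0 => szH; rewrite expr0 mulr1.
  under eq_bern_expect => b do rewrite expr0 mxE mulrC.
  rewrite bern_expectZ normrM -[leRHS]mul1r; apply: ler_pM => //.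
    by case: (i == j); rewrite /= ?normr1 ?normr0.
  exact: norm_bern_expect_prod_noise.
move=> szH.
under eq_bern_expect => b.
  rewrite exprS mxE mulr_sumr.
  over.
rewrite bern_expect_sum.
apply: (le_trans (ler_norm_sum _ _ _)).
(* The factor that the step to [q] adds to the bound: exactly the change of the product over
   [undup H] when [e] is put in front of [H]. *)
pose w (q : 'I_n) := if ed i q is Some e then (if e \in H then 1 else y * v e) else 0.
apply: (@le_trans _ _ (\sum_q w q *
   (y ^- k * \prod_(e <- undup H) (y * v e) * (y * a + k.*2%:R) ^+ t))).
  apply: ler_sum => q _; rewrite /w; case edq : (ed i q) => [e|]; last first.
    under eq_bern_expect => b do rewrite mxE edq /= mul0r mulr0 -(mul0r (noise_mx b i i)).
    by rewrite bern_expectZ !mul0r normr0.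
  under eq_bern_expect => b.
    rewrite mxE edq /= mulrA [X in X * _]mulrC -(big_cons _ _ e H xpredT (fun e => noise
      c e (b e))).
    over.
  apply: (le_trans (IH (e :: H) q _)); first by rewrite /= addSn -addnS.
  rewrite /=; case: ifP => eH; first by rewrite mul1r.
  by rewrite big_cons le_eqVlt; apply/orP; left; apply/eqP; ring.
rewrite -mulr_suml exprS [leRHS]mulrCA; apply: ler_wpM2r.
  by rewrite mulr_ge0 // exprn_ge0 // addr_ge0 // mulr_ge0 // ltW.
rewrite /w (eq_bigr (fun q => (if ed i q is Some e then (e \in H)%:R else 0) +
  (if ed i q is Some e then (if e \in H then 0 else y * v e) else 0))); last first.
  by move=> q _; case: (ed i q) => [e|]; rewrite ?addr0 //; case: (e \in H);
    rewrite ?addr0 ?add0r.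
rewrite big_split /= addrC; apply: lerD.
  apply: (@le_trans _ _ (y * \sum_q oapp v 0 (ed i q))); last by rewrite ler_pM2l.
  rewrite mulr_sumr; apply: ler_sum => q _; case: (ed i q) => [e|] /=; rewrite ?mulr0 //.
  by case: ifP => // _; rewrite mulr_ge0 // ltW.
rewrite (bigID (fun q => ed i q)) /= [X in _ + X]big1 ?addr0; last first.
  by move=> q; case: (ed i q).
apply: (@le_trans _ _ (size H)%:R); last by rewrite ler_nat; lia.
pose Q := [set q | if ed i q is Some e then e \in H else false].
apply: (@le_trans _ _ #|Q|%:R).
  rewrite -sum1_card natr_sum [leRHS]big_mkcond /= [leLHS]big_mkcond /=.
  by apply: ler_sum => q _; rewrite inE; case: (ed i q) => [e|] //=; case: (e \in H).
rewrite ler_nat -(size_map Some H) cardE -(size_map (ed i)).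
apply: uniq_leq_size => [|o].
  rewrite map_inj_in_uniq ?enum_uniq // => q q'; rewrite !mem_enum !inE.
  by case eq : (ed i q) => [e|] // _ _ /esym eq'; apply: ed_inj eq eq'.
case/mapP => q; rewrite mem_enum inE => + ->; case: (ed i q) => [e|] // eH.
exact: map_f.
Qed.

(** Here [a] bounds the row variances, so this amounts to a spectral norm of order
    [sqrt (k * (a + k))]: a factor [sqrt k] more than the true order when [a] is large. *)
Lemma bern_expect_trace_noise_mx_le : (0 < k)%N ->
  bern_expect (fun b => \tr (noise_mx b ^+ k.*2)) <=
  n%:R * (9 * k%:R * (a + k%:R)) ^+ k.
Proof.
move=> k0; have kR0 : 0 < k%:R :> R by rewrite ltr0n.
have [n0|/negbTE nn0] := eqVneq n 0%N.
  have no (i : 'I_n) : False by move: (ltn_ord i); rewrite [X in (_ < X)%N]n0.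
  rewrite (_ : n%:R = 0 :> R) ?n0 // mul0r le_eqVlt; apply/orP; left; apply/eqP.
  by apply: big1 => b _; rewrite [\tr _]big1 ?mulr0 // => i; case: (no i).
have i0 : 'I_n by apply: (@Ordinal _ 0); rewrite lt0n nn0.
have a0 : 0 <= a.
  by apply: (le_trans _ (va i0)); apply: sumr_ge0 => q _; case: (ed i0 q) => //=.
(* This choice gives [y * a <= k], so the base [y * a + 2k] is at most 3k, and y^-1 (3k)^2 = 9k (a +
   k). *)
pose y := k%:R / (a + k%:R).
have ak : 0 < a + k%:R by lra.
have y01 : 0 < y <= 1 by rewrite divr_gt0 //= ler_pdivrMr // mul1r; lra.
rewrite /mxtrace bern_expect_sum.
have -> : n%:R * (9 * k%:R * (a + k%:R)) ^+ k =
    \sum_(i < n) (y ^- k * (3 * k%:R) ^+ k.*2).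
  rewrite sumr_const card_ord -[RHS]mulr_natl; congr (_ * _).
  rewrite -mul2n exprM -exprVn -exprMn; congr (_ ^+ _).
  by rewrite /y invf_div; field; rewrite gt_eqF.
apply: ler_sum => i _.
apply: (le_trans (ler_norm _)).
have := @norm_bern_expect_walk y k.*2 [::] i i y01 erefl.
rewrite /= big_nil mulr1.
under eq_bern_expect => b do rewrite big_nil mul1r.
move=> /le_trans; apply; apply: ler_wpM2l.
  by rewrite invr_ge0 exprn_ge0 // ltW //; case/andP: y01.
have ya : y * a <= k%:R.
  by rewrite /y mulrAC ler_pdivrMr // ler_pM2l //; lra.
apply: lerXn2r; rewrite ?nnegrE.
- by rewrite addr_ge0 // mulr_ge0 //; case/andP: y01 => /ltW.
- by rewrite mulr_ge0 // ltW.
- by rewrite -mul2n natrM; lra.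
Qed.
End Matrix.
End BernoulliProduct.

(** * Quadratic forms and semidefinite matrices *)

Section LinearAlgebra.
Context {R : realType}.

Definition quad N (W : 'M[R]_N) (v : 'cV[R]_N) : R := (v^T *m W *m v) 0 0.
Definition sqn N (v : 'cV[R]_N) : R := \sum_i v i 0 ^+ 2.

Lemma sqn_ge0 N (v : 'cV[R]_N) : 0 <= sqn v.
Proof. by apply: sumr_ge0 => i _; exact: sqr_ge0. Qed.

Lemma quadE N (W : 'M[R]_N) v : quad W v = \sum_i \sum_j v i 0 * W i j * v j 0.
Proof.
rewrite /quad mxE exchange_big /=; apply: eq_bigr => j _.
by rewrite mxE mulr_suml; apply: eq_bigr => i _; rewrite mxE.
Qed.

Lemma quadD N (A B : 'M[R]_N) v : quad (A + B) v = quad A v + quad B v.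
Proof. by rewrite /quad mulmxDr mulmxDl mxE. Qed.

Lemma quadN N (A : 'M[R]_N) v : quad (- A) v = - quad A v.
Proof. by rewrite /quad mulmxN mulNmx mxE. Qed.

Lemma quadZ N a (A : 'M[R]_N) v : quad (a *: A) v = a * quad A v.
Proof. by rewrite /quad -scalemxAr -scalemxAl mxE. Qed.

Lemma quad1 N (v : 'cV[R]_N) : quad 1%:M v = sqn v.
Proof. by rewrite /quad mulmx1 mxE; apply: eq_bigr => i _; rewrite mxE expr2. Qed.

Lemma quad_conj N M (A : 'M[R]_N) (B : 'M[R]_(M, N)) v :
  quad (B *m A *m B^T) v = quad A (B^T *m v).
Proof. by rewrite /quad trmx_mul trmxK !mulmxA. Qed.

Lemma cauchy_schwarz_sum (I : finType) (a b : I -> R) :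
  (\sum_i a i * b i) ^+ 2 <= (\sum_i a i ^+ 2) * (\sum_i b i ^+ 2).
Proof.
have H : 0 <= \sum_i \sum_j (a i * b j - a j * b i) ^+ 2.
  by apply: sumr_ge0 => i _; apply: sumr_ge0 => j _; exact: sqr_ge0.
have E1 : \sum_i \sum_j (a i * b j - a j * b i) ^+ 2 =
  \sum_i \sum_j (a i ^+ 2 * b j ^+ 2) + \sum_i \sum_j (a j ^+ 2 * b i ^+ 2)
  - 2 * \sum_i \sum_j (a i * b i) * (a j * b j).
  rewrite mulr_sumr -big_split -sumrB /=; apply: eq_bigr => i _.
  by rewrite mulr_sumr -big_split -sumrB /=; apply: eq_bigr => j _; ring.
move: H; rewrite E1 [X in _ + X - _]exchange_big /=.
rewrite expr2 !big_distrlr /=; lra.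
Qed.

Lemma dot_le N (u v : 'cV[R]_N) : ((u^T *m v) 0 0) ^+ 2 <= sqn u * sqn v.
Proof.
rewrite mxE; under eq_bigr => i _ do rewrite mxE.
exact: cauchy_schwarz_sum.
Qed.

Lemma dotvv N (v : 'cV[R]_N) : (v^T *m v) 0 0 = sqn v.
Proof. by rewrite -quad1 /quad mulmx1. Qed.

Lemma sqn_mul M N (A : 'M[R]_(M, N)) v :
  sqn (A *m v) <= (\sum_i \sum_j A i j ^+ 2) * sqn v.
Proof.
rewrite /sqn mulr_suml; apply: ler_sum => i _; rewrite mxE.
exact: cauchy_schwarz_sum.
Qed.

Lemma trmx_pow N (W : 'M[R]_N) k : W^T = W -> (W ^+ k)^T = W ^+ k.
Proof.
move=> sW; elim: k => [|k IH]; first by rewrite expr0 -/(1%:M) trmx1.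
by rewrite {1}exprSr trmx_mul sW IH exprS.
Qed.

Lemma quad_sqr N (W : 'M[R]_N) v : W^T = W -> quad (W ^+ 2) v = sqn (W *m v).
Proof. by move=> sW; rewrite /quad -dotvv trmx_mul sW expr2 !mulmxA. Qed.

Lemma mxtrace_sqr N (W : 'M[R]_N) : W^T = W -> \tr (W ^+ 2) = \sum_i \sum_j W i j ^+ 2.
Proof.
move=> sW; apply: eq_bigr => i _; rewrite expr2 mxE; apply: eq_bigr => j _.
by rewrite -{2}sW mxE expr2.
Qed.

Lemma quad_sqr_le N (W : 'M[R]_N) v :
  quad W v ^+ 2 <= sqn v * sqn (W *m v).
Proof. by rewrite /quad -mulmxA dot_le. Qed.

(* Repeated squaring bounds the quadratic form by a Schatten norm without any
   appeal to the spectral theorem. *)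
Lemma quad_le_mxtrace_pow N (W : 'M[R]_N) j v (t : R) : W^T = W -> 0 <= t ->
  \tr (W ^+ (2 ^ j.+1)) <= t ^+ (2 ^ j.+1) -> quad W v <= t * sqn v.
Proof.
move=> sW t0 tW.
have s0 := sqn_ge0 v.
have step i : quad W v ^+ (2 ^ i.+1) <= sqn v ^+ (2 ^ i.+1).-1 * sqn (W ^+ (2 ^ i) *m v).
  elim: i => [|i IH]; first by rewrite expr1 expr1; exact: quad_sqr_le.
  have sWi : (W ^+ (2 ^ i))^T = W ^+ (2 ^ i) by exact: trmx_pow.
  rewrite (expnS 2 i.+1) mulnC exprM.
  apply: (@le_trans _ _ ((sqn v ^+ (2 ^ i.+1).-1 * sqn (W ^+ (2 ^ i) *m v)) ^+ 2)).
    apply: lerXn2r => //; rewrite nnegrE.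
      by rewrite expnS exprM exprn_ge0 // sqr_ge0.
    by rewrite mulr_ge0 ?exprn_ge0 ?sqn_ge0.
  rewrite -(quad_sqr _ sWi) -exprM -expnSr exprMn.
  apply: (@le_trans _ _ ((sqn v ^+ (2 ^ i.+1).-1) ^+ 2 * (sqn v * sqn (W ^+ (2 ^ i.+1) *m
    v)))).
    by apply: ler_wpM2l; [rewrite exprn_ge0 // exprn_ge0|exact: quad_sqr_le].
  rewrite mulrA -exprM -exprSr (_ : ((2 ^ i.+1).-1 * 2).+1 = (2 ^ i.+1 * 2).-1) //.
  by have := expn_gt0 2 i.+1; lia.
rewrite leNgt; apply/negP => lt_q.
have sWj : (W ^+ (2 ^ j))^T = W ^+ (2 ^ j) by exact: trmx_pow.
have e0 : (0 < 2 ^ j.+1)%N by rewrite expn_gt0.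
suff : quad W v ^+ (2 ^ j.+1) <= (t * sqn v) ^+ (2 ^ j.+1).
  have ts0 : 0 <= t * sqn v by exact: mulr_ge0.
  by rewrite ler_pXn2r ?nnegrE ?(le_trans ts0 (ltW lt_q)) // leNgt lt_q.
apply: (le_trans (step j)).
apply: (@le_trans _ _ (sqn v ^+ (2 ^ j.+1).-1 * (\tr (W ^+ (2 ^ j.+1)) * sqn v))).
  apply: ler_wpM2l; first exact: exprn_ge0.
  by rewrite expnSr exprM mxtrace_sqr // sqn_mul.
rewrite mulrCA -exprSr prednK // exprMn.
by apply: ler_wpM2r => //; exact: exprn_ge0.
Qed.

(** Cholesky factorization by induction on the size: a positive pivot leaves a positive semidefinite
    Schur complement, a zero pivot forces the rest of its row to vanish. *)
Lemma psd_gram N (X : 'M[R]_N) : psd X -> exists L : 'M[R]_N, X = L *m L^T.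
Proof.
elim: N X => [|N IH] X; first by exists 0; apply/matrixP => -[].
move: X; change (forall X : 'M[R]_(1 + N), psd X ->
  exists L : 'M[R]_(1 + N), X = L *m L^T) => X.
rewrite -(submxK X).
move: (ulsubmx X) (ursubmx X) (dlsubmx X) (drsubmx X) => a b b' C.
move=> [sX pX].
move: (sX); rewrite tr_block_mx => /eq_block_mx[_ bT bT' sC].
have qX (s : 'cV[R]_1) w : 0 <=
  (s^T *m a *m s + s^T *m b *m w + w^T *m b^T *m s + w^T *m C *m w) 0 0.
  have := pX (col_mx s w).
  rewrite tr_col_mx mul_row_block mul_row_col !mulmxDl bT' !addrA.
  by rewrite -!addrA [X in _ + X]addrCA !addrA.
pose a0 := a 0 0.
have aE : a = a0%:M by apply/matrixP => i j; rewrite !ord1 mxE eqxx.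
have qX' (s : R) w : 0 <= s ^+ 2 * a0 + 2 * s * (b *m w) 0 0 + quad C w.
  have := qX s%:M w; rewrite aE tr_scalar_mx !mul_scalar_mx -!scalemxAl.
  rewrite !mul_mx_scalar -trmx_mul /quad; set z := b *m w; set q := _ *m w.
  by rewrite !mxE eqxx !mulr1n; move: (z 0 0) (q 0 0) => *; lra.
have a0_ge0 : 0 <= a0.
  by have := qX' 1 0; rewrite /quad !mulmx0 !mxE; lra.
have [a0e|a0n] := eqVneq a0 0.
  have b0 : b = 0.
    apply/matrixP => i j; rewrite ord1 [RHS]mxE.
    pose w : 'cV[R]_N := delta_mx j 0.
    have E : (b *m w) 0 0 = b 0 j.
      rewrite mxE (bigD1 j) //= big1 ?addr0 ?mxE ?eqxx ?mulr1 // => k kj.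
      by rewrite mxE (negbTE kj) mulr0.
    apply/eqP/negPn/negP => bj.
    (* With a zero pivot the form is affine in its first coordinate; this value makes it equal to
       -1. *)
    have := qX' (- (quad C w + 1) / (2 * b 0 j)) w; rewrite E a0e.
    have -> : 2 * (- (quad C w + 1) / (2 * b 0 j)) * b 0 j = - (quad C w + 1).
      by field.
    lra.
  have [|L CL] := IH C.
    by split => // w; have := qX' 0 w; rewrite /quad; lra.
  exists (block_mx 0 0 0 L).
  rewrite tr_block_mx mulmx_block !trmx0 !mulmx0 !mul0mx !addr0 !add0r -CL.
  by rewrite aE a0e -bT' b0 trmx0 raddf0.
have a0_gt0 : 0 < a0 by rewrite lt_def a0n.
pose sa := Num.sqrt a0.
have sa2 : sa * sa = a0 by rewrite -expr2 sqr_sqrtr.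
have sa0 : sa != 0 by rewrite sqrtr_eq0 -ltNge.
have [|L CL] := IH (C - a0^-1 *: (b^T *m b)).
  split; first by rewrite linearB linearZ /= trmx_mul trmxK sC.
  move=> w; rewrite -/(quad _ w) quadD quadN quadZ.
  have -> : quad (b^T *m b) w = ((b *m w) 0 0) ^+ 2.
    by rewrite /quad mulmxA -trmx_mul -mulmxA mxE big_ord1 mxE expr2.
  (* The minimizing first coordinate for fixed [w]; the minimum is the form of the Schur
     complement. *)
  have := qX' (- ((b *m w) 0 0) / a0) w.
  set z := (b *m w) 0 0.
  have -> : (- z / a0) ^+ 2 * a0 + 2 * (- z / a0) * z = - (a0^-1 * z ^+ 2) by field.
  lra.
exists (block_mx sa%:M 0 (sa^-1 *: b^T) L).
rewrite tr_block_mx mulmx_block trmx0 !mulmx0 !mul0mx !addr0 -CL.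
rewrite tr_scalar_mx linearZ /= trmxK -!scalemxAl -!scalemxAr !mul_scalar_mx.
rewrite !mul_mx_scalar !scalerA mulVf // !scale1r scale_scalar_mx sa2 -aE bT'.
by rewrite -invfM sa2 addrC subrK.
Qed.

(** With X = L L^T the trace is the sum of the values of the form [S] on the columns of L. *)
Lemma psd_mxtrace_mul_ge0 N (X S : 'M[R]_N) : psd X -> psd S -> 0 <= \tr (X *m S).
Proof.
move=> /psd_gram[L ->] [_ pS]; rewrite mxtrace_mulC mulmxA mxtrace_mulC.
apply: sumr_ge0 => i _.
rewrite (_ : _ i i = ((col i L)^T *m S *m col i L) 0 0) ?pS // -mulmxA !mxE.
apply: eq_bigr => k _; rewrite !mxE; congr (_ * _).
by apply: eq_bigr => j _; rewrite mxE.
Qed.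

End LinearAlgebra.

(** * The optimality system of the outlier coordinates *)

Section ReducedProblem.
Context {R : realType}.
Variables (r m : nat) (alpha : R) (B : 'M[R]_(r, m)) (D : 'M[R]_m).
(** Up to a constant, the objective of the semidefinite program at the Gram matrix in which the
    inliers of community k sit at the k-th unit vector and outlier j at column j of [Z]. Then [B] is
    the inlier-outlier cost summed over each community and [D] the cost among outliers. *)
Definition reduced_cost (Z : 'M[R]_(r, m)) : R :=
  \sum_k (2 * (\sum_j Z k j * B k j) + \sum_j \sum_j' Z k j * D j j' * Z k j').

Section Minimizer.
Import numFieldNormedType.Exports.
Local Open Scope classical_set_scope.
Local Open Scope ring_scope.


Lemma continuous_sumr (T : topologicalType) (I : Type) (s : seq I)
    (F : I -> T -> R) :
  (forall i, continuous (F i)) -> continuous (fun x => \sum_(i <- s) F i x).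
Proof.
move=> cF x; elim: s => [|i s IH].
  by under eq_fun do rewrite big_nil; exact: cst_continuous.
under eq_fun do rewrite big_cons.
by apply: continuousD => //; exact: cF.
Qed.

Lemma continuous_mulr (T : topologicalType) (f g : T -> R) :
  continuous f -> continuous g -> continuous (fun x => f x * g x).
Proof. by move=> cf cg x; apply: continuousM; [exact: cf|exact: cg]. Qed.

Lemma continuous_addr (T : topologicalType) (f g : T -> R) :
  continuous f -> continuous g -> continuous (fun x => f x + g x).
Proof. by move=> cf cg x; apply: continuousD; [exact: cf|exact: cg]. Qed.

Lemma reduced_cost_minimizer : exists Z : 'M[R]_(r, m),
  [/\ (forall k j, 0 <= Z k j), (forall j, \sum_k Z k j ^+ 2 <= 1) &
   forall Z' : 'M[R]_(r, m), (forall k j, 0 <= Z' k j) ->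
     (forall j, \sum_k Z' k j ^+ 2 <= 1) -> reduced_cost Z <= reduced_cost Z'].
Proof.
(* The column constraint forces nonnegative entries into [0, 1], so restricting to the cube loses no
   competitor, and the cube supplies compactness. *)
pose box := [set v : 'rV[R]_(r * m) | forall i, 0 <= v ord0 i <= 1]%classic.
pose ball := [set v : 'rV[R]_(r * m) |
  forall j, \sum_k (vec_mx v k j : R) ^+ 2 <= 1]%classic.
have cvec k j : continuous (fun v : 'rV[R]_(r * m) => vec_mx v k j : R).
  move=> v; rewrite (_ : (fun v => _) =
    (fun v : 'rV[R]_(r * m) => v ord0 (mxvec_index k j))).
    exact: coord_continuous.
  by apply: funext => w; rewrite mxE.
have cbox : compact box.
  rewrite (_ : box = [set v : 'rV[R]_(r * m) | forall i, `[0,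
    1]%classic (v ord0 i)]%classic).
    by apply: (@rV_compact R _ (fun=> `[0, 1]%classic)) => i; exact: segment_compact.
  by apply/seteqP; split => v h i; have := h i; rewrite /= in_itv.
have clball : closed ball.
  rewrite (_ : ball = (\bigcap_(j in [set: 'I_m]) [set v : 'rV[R]_(r * m) | \sum_k
    (vec_mx v k j : R) ^+ 2 <= 1])%classic).
    apply: closed_bigI => j _.
    apply: (@preimage_closed _ _ (fun v : 'rV[R]_(r * m) => \sum_k (vec_mx v k j : R) ^+ 2)
      [set x | x <= 1]%classic); last exact: closed_le.
    move=> v _; apply: continuous_sumr => k.
    by under eq_fun do rewrite expr2; apply: continuous_mulr; exact: cvec.
  by apply/seteqP; split => v /= h j => [_|]; apply: h.
have cK := compact_closedI cbox clball.
have K0 : ((box `&` ball) !=set0)%classic.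
  exists 0; split => [i|j] /=; first by rewrite mxE lexx ler01.
  by rewrite big1 // => k _; rewrite !mxE expr0n.
have cf : {within (box `&` ball)%classic, continuous (fun v => reduced_cost (vec_mx v))}.
  apply: continuous_subspaceT; apply: continuous_sumr => k.
  apply: continuous_addr.
    apply: continuous_mulr; first exact: cst_continuous.
    apply: continuous_sumr => j; apply: continuous_mulr; first exact: cvec.
    exact: cst_continuous.
  apply: continuous_sumr => j; apply: continuous_sumr => j'.
  apply: continuous_mulr; last exact: cvec.
  by apply: continuous_mulr; [exact: cvec|exact: cst_continuous].
have [v /[!inE] -[bv bav] vmin] := compact_EVT_min K0 cK cf.
exists (vec_mx v); split => [k j|//|Z' Z0 Z1].
  by have := bv (mxvec_index k j); rewrite mxE => /andP[].
rewrite -[Z']mxvecK; apply: vmin; rewrite inE; split => [i|j] /=; last by rewrite mxvecK.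
case/mxvec_indexP: i => k j; rewrite mxvecE Z0 /=.
have : Z' k j ^+ 2 <= 1.
  by apply: le_trans (Z1 j); rewrite (bigD1 k) //= lerDl sumr_ge0 // => *; exact: sqr_ge0.
by rewrite expr_le1.
Qed.

End Minimizer.

(* The minimum of [reduced_cost] over one column z, the others being fixed, is a
   quadratic problem with scalar Hessian, hence explicitly solvable:
   z = b^- / max(alpha, |b^-|). *)
Lemma reduced_kkt :
  0 < alpha -> D^T = D -> (forall j, D j j = alpha) ->
    exists (Z : 'M[R]_(r, m)) (mu : 'rV[R]_m),
  [/\ (forall k j, 0 <= Z k j) /\ (forall j, \sum_k Z k j ^+ 2 <= 1),
      (forall j, 0 <= mu 0 j),
      (forall j, mu 0 j != 0 -> \sum_k Z k j ^+ 2 = 1),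
      (forall k j, 0 <= (B + Z *m (D + diag_mx mu)) k j) &
      (forall k j, Z k j != 0 -> (B + Z *m (D + diag_mx mu)) k j = 0)].
Proof.
move=> alpha0 DT Djj; have [Z [Z0 Z1 Zmin]] := reduced_cost_minimizer.
(* [g] is half the gradient and [b] its part that does not involve column [j], as D j j = alpha.
   [bm] is the negative part of [b], [M] the maximum of alpha and the norm of [bm]; [M - alpha] will
   be the multiplier of the norm constraint. *)
pose g k j := (B + Z *m D) k j.
pose b k j := g k j - alpha * Z k j.
pose bm k j := if 0 <= b k j then 0 else - b k j.
pose s j := Num.sqrt (\sum_k bm k j ^+ 2).
pose M j := if s j <= alpha then alpha else s j.
pose zs k j := bm k j / M j.
have M0 j : 0 < M j by rewrite /M; case: (leP (s j) alpha) => h; lra.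
have aM j : alpha <= M j by rewrite /M; case: (leP (s j) alpha) => h; lra.
have sM j : s j <= M j by rewrite /M; case: (leP (s j) alpha) => h; lra.
have bm0 k j : 0 <= bm k j by rewrite /bm; case: (leP 0 (b k j)) => h; lra.
have bmb k j : bm k j * (bm k j + b k j) = 0.
  by rewrite /bm; case: (leP 0 (b k j)) => h; rewrite ?mul0r // addNr mulr0.
have bmp k j : 0 <= bm k j + b k j.
  by rewrite /bm; case: (leP 0 (b k j)) => h; lra.
have s2 j : s j ^+ 2 = \sum_k bm k j ^+ 2.
  by rewrite sqr_sqrtr // sumr_ge0 // => k _; exact: sqr_ge0.
have zsn j : \sum_k zs k j ^+ 2 = s j ^+ 2 / M j ^+ 2.
  by rewrite s2 mulr_suml; apply: eq_bigr => k _; rewrite expr_div_n.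
have zs0 k j : 0 <= zs k j by rewrite divr_ge0 // ltW.
have zs1 j : \sum_k zs k j ^+ 2 <= 1.
  rewrite zsn ler_pdivrMr ?exprn_gt0 // mul1r; apply: lerXn2r;
    rewrite ?nnegrE ?sqrtr_ge0 ?sM //.
  exact: ltW.
have zsM j : M j != alpha -> \sum_k zs k j ^+ 2 = 1.
  move=> Ma; rewrite zsn; have := M0 j; move: Ma; rewrite /M.
  by case: (leP (s j) alpha) => h; rewrite ?eqxx // => _ s0;
    rewrite divff // expf_neq0 // gt_eqF.
(* The optimality of [Z] is tested against the single competitor obtained by replacing column [j]
   with the explicit minimizer [zs]. *)
have Zzs j k0 : Z k0 j = zs k0 j.
  pose Z' : 'M[R]_(r, m) := \matrix_(k, j') if j' == j then zs k j' else Z k j'.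
  have := Zmin Z'.
  have -> : reduced_cost Z' = reduced_cost Z +
     \sum_k (2 * (zs k j - Z k j) * g k j + alpha * (zs k j - Z k j) ^+ 2).
    rewrite /reduced_cost -big_split /=; apply: eq_bigr => k _.
    pose t := zs k j - Z k j.
    have Z'E j' : Z' k j' = Z k j' + (j' == j)%:R * t.
      by rewrite mxE /t; case: eqP => [->|_] /=; ring.
    have S1 (F : 'I_m -> R) : \sum_j' (j' == j)%:R * F j' = F j.
      rewrite (bigD1 j) //= eqxx mul1r big1 ?addr0 // => i /negbTE ->.
      by rewrite mul0r.
    have -> : \sum_j' Z' k j' * B k j' = \sum_j' Z k j' * B k j' + t * B k j.
      under eq_bigr => j' _ do rewrite Z'E mulrDl -mulrA.
      by rewrite big_split /= S1.
    have -> : \sum_j1 \sum_j2 Z' k j1 * D j1 j2 * Z' k j2 =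
      \sum_j1 \sum_j2 Z k j1 * D j1 j2 * Z k j2 + 2 * t * (\sum_j1 Z k j1 * D j1 j)
      + t ^+ 2 * D j j.
      transitivity (\sum_j1 \sum_j2 Z k j1 * D j1 j2 * Z k j2
         + \sum_j1 \sum_j2 (j2 == j)%:R * (Z k j1 * D j1 j2 * t)
         + \sum_j1 (j1 == j)%:R * (\sum_j2 t * D j1 j2 * Z k j2)
         + \sum_j1 (j1 == j)%:R * (\sum_j2 (j2 == j)%:R * (t ^+ 2 * D j1 j2))).
        rewrite -!big_split /=; apply: eq_bigr => j1 _; rewrite !mulr_sumr -!big_split /=.
        by apply: eq_bigr => j2 _; rewrite !Z'E; ring.
      rewrite !S1; under [X in _ + X + _ + _ = _]eq_bigr => j1 _ do rewrite S1.
      rewrite -mulr_suml.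
      have -> : \sum_j2 t * D j j2 * Z k j2 = t * \sum_j1 Z k j1 * D j1 j.
        rewrite mulr_sumr; apply: eq_bigr => j2 _.
        by rewrite -{1}DT mxE; ring.
      ring.
    rewrite Djj /g !mxE -/t; ring.
  have /[swap]/[apply] : forall j', \sum_k Z' k j' ^+ 2 <= 1.
    move=> j'; rewrite (eq_bigr (fun k => (if j' == j then zs k j' else Z k j') ^+ 2)).
      by case: eqP => _; [exact: zs1|exact: Z1].
    by move=> k _; rewrite mxE.
  have /[swap]/[apply] : forall k j', 0 <= Z' k j'.
    by move=> k j'; rewrite mxE; case: eqP.
  rewrite lerDl => le0.
  have Mzs k : M j * zs k j = bm k j by rewrite /zs mulrC divfK // gt_eqF.
  have dot1 : \sum_k zs k j * Z k j <= 1.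
    apply: (@le_trans _ _ (\sum_k (zs k j ^+ 2 + Z k j ^+ 2) / 2)).
      by apply: ler_sum => k _; have := sqr_ge0 (zs k j - Z k j); lra.
    by rewrite -mulr_suml big_split /=; have := zs1 j; have := Z1 j; lra.
  have mu0 : 0 <= (M j - alpha) * (\sum_k zs k j ^+ 2 - \sum_k zs k j * Z k j).
    have [->|/zsM ->] := eqVneq (M j) alpha; first by rewrite subrr mul0r.
    by rewrite mulr_ge0 // subr_ge0.
  (* The change of cost is minus a sum of three nonnegative terms, while optimality makes it
     nonnegative. All three vanish, and alpha > 0 in the first yields Z = zs in this column. *)
  have key : \sum_k (2 * (zs k j - Z k j) * g k j + alpha * (zs k j - Z k j) ^+ 2)
     = - (alpha * \sum_k (Z k j - zs k j) ^+ 2) - 2 * (\sum_k Z k j * (bm k j + b k j))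
       - 2 * ((M j - alpha) * (\sum_k zs k j ^+ 2 - \sum_k zs k j * Z k j)).
    rewrite -sumrB !mulr_sumr -!sumrN -!big_split /=; apply: eq_bigr => k _.
    have zb : zs k j * (M j * zs k j + b k j) = 0.
      by rewrite Mzs /zs mulrAC bmb mul0r.
    have -> : g k j = b k j + alpha * Z k j by rewrite /b subrK.
    apply/eqP; rewrite -subr_eq0 -(Mzs k); apply/eqP.
    transitivity (2 * (zs k j * (M j * zs k j + b k j))); last by rewrite zb mulr0.
    ring.
  have Zb : 0 <= \sum_k Z k j * (bm k j + b k j).
    by apply: sumr_ge0 => k _; exact: mulr_ge0.
  have : \sum_k (Z k j - zs k j) ^+ 2 <= 0.
    by rewrite -(pmulr_rle0 _ alpha0); lra.
  have sq0 k : 0 <= (Z k j - zs k j) ^+ 2 by exact: sqr_ge0.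
  rewrite le_eqVlt ltNge sumr_ge0 // orbF psumr_eq0 // => /allP/(_ k0).
  by rewrite mem_index_enum sqrf_eq0 subr_eq0 => /(_ isT)/eqP.
exists Z, (\row_j (M j - alpha)).
have kkt k j : (B + Z *m (D + diag_mx (\row_j (M j - alpha)))) k j = bm k j + b k j.
  rewrite mulmxDr addrA mxE -/(g k j) mul_mx_diag !mxE /b.
  have -> : bm k j = M j * Z k j by rewrite Zzs /zs mulrC divfK // gt_eqF.
  ring.
split => // [j|j|k j|k j].
- by rewrite mxE subr_ge0.
- by rewrite mxE subr_eq0 => /zsM <-; apply: eq_bigr => k _; rewrite Zzs.
- by rewrite kkt.
- rewrite kkt Zzs => z0; have := bmb k j; move/eqP;
  rewrite mulf_eq0 => /orP[/eqP b0|/eqP//].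
  by move: z0; rewrite /zs b0 mul0r eqxx.
Qed.

End ReducedProblem.

(** * The dual certificate *)

Section Dual.
Context {R : realType}.

Lemma sdp_costE N (alpha lambda : R) (A : 'M[R]_N) i j :
  sdp_cost alpha lambda A i j =
  (if i == j then alpha else lambda) - A i j.
Proof. by rewrite !mxE; case: eqP => _; rewrite ?mulr1n ?mulr0n; ring. Qed.

Lemma psd_mul_tr N M (L : 'M[R]_(N, M)) : psd (L *m L^T).
Proof.
split=> [|v]; first by rewrite trmx_mul trmxK.
by rewrite -/(quad _ v) -[L in L *m _]mulmx1 quad_conj quad1 sqn_ge0.
Qed.

(** Complementary slackness, with [S - E] as the multiplier of the entrywise bounds: the cost of [X]
    minus that of [X'] equals tr (X S) plus the sum of the products in the sign condition. All these
    terms are nonnegative, so optimality kills each of them. *)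
Lemma sdp_solution_unique N (E X X' S : 'M[R]_N) :
  sdp_feasible X' -> psd S -> S *m X' = 0 ->
  (forall Y, sdp_feasible Y -> forall i j, 0 <= (X' i j - Y i j) * (S - E) i j) ->
  sdp_solution E X -> forall i j, (S - E) i j != 0 -> X i j = X' i j.
Proof.
move=> fX' pS SX' sgn [fX optX] i j Tij.
have := optX _ fX'; have [pX _] := fX; have := psd_mxtrace_mul_ge0 pX pS.
have trE (Y Z : 'M[R]_N) : \tr (Y^T *m Z) = \sum_a \sum_b Y a b * Z a b.
  rewrite exchange_big /=; apply: eq_bigr => b _; rewrite mxE.
  by apply: eq_bigr => a _; rewrite mxE.
have tX' : \tr (X'^T *m S) = 0.
  by have [[-> _] _] := fX'; rewrite mxtrace_mulC SX' linear0.
have D : \tr (X^T *m E) - \tr (X'^T *m E) =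
   \tr (X *m S) + \sum_a \sum_b (X' a b - X a b) * (S - E) a b.
  have [sX _] := pX.
  rewrite (_ : \tr (X *m S) = \tr (X^T *m S) - \tr (X'^T *m S)); last first.
    by rewrite tX' subr0 sX.
  rewrite !trE -!sumrB -big_split /=.
  apply: eq_bigr => a _; rewrite -!sumrB -big_split /=; apply: eq_bigr => b _.
  rewrite !mxE; ring.
move=> XS0 leE.
have : \sum_a \sum_b (X' a b - X a b) * (S - E) a b <= 0 by lra.
rewrite pair_big /= le_eqVlt ltNge sumr_ge0 ?orbF; last by move=> *; exact: sgn.
rewrite psumr_eq0; last by move=> *; exact: sgn.
move/allP/(_ (i, j)); rewrite mem_index_enum /= => /(_ isT).
by rewrite mulf_eq0 (negbTE Tij) orbF subr_eq0 => /eqP.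
Qed.

Lemma posdef_unitmx N (M : 'M[R]_N) (D : 'I_N -> R) :
  (forall j, 0 < D j) -> (forall v : 'cV[R]_N, \sum_j D j * v j 0 ^+ 2 <= quad M v) ->
  M \in unitmx.
Proof.
move=> D0 DM; rewrite unitmxE unitfE; apply/det0P => -[v v0 vM].
have := DM v^T; rewrite /quad trmxK vM mul0mx mxE.
under eq_bigr => j _ do rewrite mxE.
rewrite le_eqVlt ltNge sumr_ge0 ?orbF => [|j _]; last by rewrite mulr_ge0 ?sqr_ge0 // ltW.
rewrite psumr_eq0 => [|j _]; last by rewrite mulr_ge0 ?sqr_ge0 // ltW.
move=> /allP h; move/negP: v0; apply; apply/eqP/rowP => j; rewrite mxE.
have := h j; rewrite mem_index_enum /= => /(_ isT).
by rewrite mulf_eq0 gt_eqF //= sqrf_eq0 => /eqP.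
Qed.

End Dual.

(** * Averaging, centering and Laplacians along the communities *)

Section Blocks.
Context {R : realType}.
Variables (n r : nat) (kap : 'I_n -> 'I_r).

Definition block_size k : R := #|[set i | kap i == k]|%:R.
Definition indmx : 'M[R]_(n, r) := \matrix_(i, k) (kap i == k)%:R.
(** For nonempty blocks, the orthogonal projection onto the vectors that are constant on each
    block. *)
Definition avgmx : 'M[R]_n :=
  indmx *m diag_mx (\row_k (block_size k)^-1) *m indmx^T.

Lemma mul_indmx p (Y : 'M[R]_(r, p)) i j : (indmx *m Y) i j = Y (kap i) j.
Proof.
rewrite mxE (bigD1 (kap i)) //= !mxE eqxx mul1r big1 ?addr0 // => k ki.
by rewrite mxE eq_sym (negbTE ki) mul0r.
Qed.

Lemma mulmx_ind p (Y : 'M[R]_(p, n)) i k : (Y *m indmx) i k = \sum_(a | kap a == k) Y i a.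
Proof.
rewrite mxE [RHS]big_mkcond; apply: eq_bigr => a _; rewrite mxE.
by case: eqP; rewrite ?mulr1 ?mulr0.
Qed.

Lemma tr_indmx_mul p (Y : 'M[R]_(n, p)) k j :
  (indmx^T *m Y) k j = \sum_(a | kap a == k) Y a j.
Proof.
rewrite mxE [RHS]big_mkcond; apply: eq_bigr => a _; rewrite !mxE.
by case: eqP; rewrite ?mul1r ?mul0r.
Qed.

Lemma sum_blk (c : R) k : \sum_(a | kap a == k) c = c * block_size k.
Proof. by rewrite sumr_const mulr_natr /block_size cardsE. Qed.

Lemma tr_indmxK : indmx^T *m indmx = diag_mx (\row_k block_size k).
Proof.
apply/matrixP => k k'; rewrite tr_indmx_mul !mxE.
under eq_bigr => a /eqP ak do rewrite mxE ak.
by rewrite sum_blk; case: eqP => [->|]; rewrite ?mul1r ?mul0r ?mulr1n ?mulr0n.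
Qed.

Hypothesis blk0 : forall k, 0 < block_size k.

Lemma avgmx_ind : avgmx *m indmx = indmx.
Proof.
rewrite /avgmx -!mulmxA tr_indmxK mulmx_diag.
rewrite (_ : (\row_i _) = const_mx 1) ?diag_const_mx ?mulmx1 //.
by apply/rowP => k; rewrite !mxE mulVf // gt_eqF.
Qed.

Lemma tr_avgmx : avgmx^T = avgmx.
Proof. by rewrite /avgmx !trmx_mul trmxK tr_diag_mx mulmxA. Qed.

Definition cenmx : 'M[R]_n := 1%:M - avgmx.

Lemma cenmx_ind : cenmx *m indmx = 0.
Proof. by rewrite mulmxBl mul1mx avgmx_ind subrr. Qed.

Lemma tr_cenmx : cenmx^T = cenmx.
Proof. by rewrite linearB /= trmx1 tr_avgmx. Qed.

Lemma tr_indmx_cen : indmx^T *m cenmx = 0.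
Proof. by apply: trmx_inj; rewrite trmx_mul tr_cenmx trmxK cenmx_ind trmx0. Qed.

Lemma mulmx_avg p (Y : 'M[R]_(p, n)) i a :
  (Y *m avgmx) i a = (Y *m indmx) i (kap a) / block_size (kap a).
Proof.
rewrite /avgmx !mulmxA mxE (bigD1 (kap a)) //= big1 ?addr0.
  by rewrite mul_mx_diag !mxE eqxx mulr1.
by move=> k ka; rewrite !mxE eq_sym (negbTE ka) mulr0.
Qed.

Lemma avgmx_mul p (Y : 'M[R]_(n, p)) a i :
  (avgmx *m Y) a i = (indmx^T *m Y) (kap a) i / block_size (kap a).
Proof.
have -> : (avgmx *m Y) a i = (Y^T *m avgmx) i a.
  by rewrite -[in RHS]tr_avgmx -trmx_mul [RHS]mxE.
rewrite mulmx_avg; congr (_ / _).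
by rewrite -[in LHS](trmxK indmx) -trmx_mul [LHS]mxE.
Qed.

(* Entrywise form of [A - N A N] where N is the block-centering projection. *)
Lemma sub_cen_conjE (A : 'M[R]_n) (x e : R) i a :
  A^T = A ->
  (forall b, kap b = kap i -> `|(A *m indmx) b (kap a) / block_size (kap a) - x| <= e) ->
  (forall b, kap b = kap a -> `|(A *m indmx) b (kap i) / block_size (kap i) - x| <= e) ->
  `|(A - cenmx *m A *m cenmx) i a - x| <= 3 * e.
Proof.
move=> sA hi ha.
have -> : A - cenmx *m A *m cenmx = A *m avgmx + avgmx *m A - avgmx *m (A *m avgmx).
  rewrite /cenmx !mulmxBl !mulmxBr !mul1mx !mulmx1 mulmxA.
  move: (A *m avgmx) (avgmx *m A) (avgmx *m A *m avgmx) => U V W.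
  by apply/matrixP => ? ?; rewrite !mxE; ring.
pose ra b k := (A *m indmx) b k / block_size k.
have E1 b : (A *m avgmx) b a = ra b (kap a) by rewrite mulmx_avg.
have E2 : (avgmx *m A) i a = ra a (kap i).
  by rewrite avgmx_mul /ra -{1}sA -trmx_mul [X in X / _]mxE.
have E3 : `|(avgmx *m (A *m avgmx)) i a - x| <= e.
  rewrite avgmx_mul tr_indmx_mul.
  under eq_bigr => b _ do rewrite E1.
  rewrite -(ler_pM2r (blk0 (kap i))) -[X in _ * X <= _](gtr0_norm (blk0 _)) -normrM.
  rewrite mulrBl divfK ?gt_eqF // -sum_blk -sumrB -sum_blk.
  by apply: (le_trans (ler_norm_sum _ _ _)); apply: ler_sum => b /eqP; exact: hi.
have := hi i erefl; have := ha a erefl; move: E3.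
have -> (U V W : 'M[R]_n) : (U + V - W) i a = U i a + V i a - W i a by rewrite !mxE.
rewrite E1 E2 -!/(ra _ _); move: (ra i _) (ra a _) ((_ *m _) i a) => y z t.
rewrite !ler_norml => /andP[? ?] /andP[? ?] /andP[? ?].
by apply/andP; split; lra.
Qed.

(* A multiple of the Laplacian of the complete graph on each block. *)
Definition lapmx (nu : 'I_r -> R) : 'M[R]_n :=
  \matrix_(i, a) (if kap i == kap a then
    nu (kap i) * ((i == a)%:R * block_size (kap i) - 1) else 0).

Lemma tr_lapmx nu : (lapmx nu)^T = lapmx nu.
Proof.
apply/matrixP => i a; rewrite !mxE [kap a == _]eq_sym [a == i]eq_sym.
by case: eqP => // ->.
Qed.

Lemma lapmx_ind nu : lapmx nu *m indmx = 0.
Proof.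
apply/matrixP => i k; rewrite mulmx_ind mxE.
under eq_bigr => a /eqP ak do rewrite mxE ak.
have [<-|ki] := eqVneq (kap i) k; last by rewrite big1.
rewrite -mulr_sumr sumrB sum_blk mul1r -mulr_suml (bigD1 i) //= eqxx big1 ?addr0.
  by rewrite mul1r subrr mulr0.
by move=> a /andP[_ /negbTE]; rewrite eq_sym => ->.
Qed.

Lemma quad_lapmx nu (u : 'cV[R]_n) : indmx^T *m u = 0 ->
  quad (lapmx nu) u = \sum_i nu (kap i) * block_size (kap i) * u i 0 ^+ 2.
Proof.
move=> u0; rewrite quadE; apply: eq_bigr => i _.
have s0 : \sum_(a | kap a == kap i) u a 0 = 0.
  by rewrite -tr_indmx_mul u0 mxE.
transitivity (\sum_(a | kap a == kap i) u i 0 * nu (kap i) * ((i == a)%:R * block_size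
  (kap i)) * u a 0
   - \sum_(a | kap a == kap i) u i 0 * nu (kap i) * u a 0).
  rewrite -sumrB [RHS]big_mkcond; apply: eq_bigr => a _; rewrite mxE eq_sym.
  by case: eqP => // _; [ring|rewrite mulr0 mul0r].
rewrite -mulr_sumr s0 mulr0 subr0 (bigD1 i) //= eqxx big1 ?addr0; first by rewrite /=; ring.
by move=> a /andP[_ /negbTE]; rewrite eq_sym => ->; rewrite !(mul0r, mulr0).
Qed.

Lemma quad_ind_eq0 (Y : 'M[R]_(r, n)) (u : 'cV[R]_n) : indmx^T *m u = 0 ->
  quad (indmx *m Y) u = 0.
Proof.
by move=> u0; rewrite /quad mulmxA -[X in X *m _ *m _](trmxK) trmx_mul trmxK u0 trmx0
  !mul0mx mxE.
Qed.

Lemma quad_cen (A : 'M[R]_n) v : A^T = A -> A *m indmx = 0 ->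
  quad A v = quad A (cenmx *m v).
Proof.
move=> sA A0.
have AP : A *m cenmx = A.
  by rewrite /cenmx mulmxBr mulmx1 /avgmx !mulmxA A0 !mul0mx subr0.
have PA : cenmx *m A = A by rewrite -{1}sA -tr_cenmx -trmx_mul AP sA.
by rewrite -{1}AP -{1}PA -{2}tr_cenmx quad_conj tr_cenmx.
Qed.
End Blocks.

(** * Construction of the certificate and exact recovery of the inlier block *)

Section Certificate.
Context {R : realType}.

Lemma sdp_cost_block n m (alpha lambda : R) (A11 : 'M[R]_n) (A12 : 'M[R]_(n, m)) A22 :
  sdp_cost alpha lambda (block_mx A11 A12 A12^T A22) =
  block_mx (sdp_cost alpha lambda A11) (const_mx lambda - A12)
    (const_mx lambda - A12)^T (sdp_cost alpha lambda A22).
Proof.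
apply/matrixP => i j; rewrite sdp_costE.
case: (split_ordP i) => i' ->; case: (split_ordP j) => j' ->;
  rewrite ?block_mxEul ?block_mxEur ?block_mxEdl ?block_mxEdr ?sdp_costE.
- by rewrite (inj_eq (@lshift_inj _ _)).
- by rewrite eq_lrshift !mxE.
- by rewrite eq_rlshift !mxE.
- by rewrite (inj_eq (@rshift_inj _ _)).
Qed.

Lemma reduced_kkt_sdp r m (alpha lambda : R) (Eb : 'M[R]_(r, m)) (A22 : 'M[R]_m) :
  A22^T = A22 -> (forall j, A22 j j = 0) -> 3 * m%:R <= alpha ->
  exists (Z : 'M[R]_(r, m)) (mu : 'rV[R]_m),
  let M := sdp_cost alpha lambda A22 + diag_mx mu in
  [/\ (forall k j, 0 <= Z k j) /\ (forall j, \sum_k Z k j ^+ 2 <= 1),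
      (forall j, 0 <= mu 0 j),
      (forall j, mu 0 j != 0 -> \sum_k Z k j ^+ 2 = 1),
      (forall k j, 0 <= (Eb + Z *m M) k j) &
      (forall k j, Z k j != 0 -> (Eb + Z *m M) k j = 0)].
Proof.
(* Without outliers alpha may be 0, so the positivity needed by [reduced_kkt] is only available when
   m > 0. *)
move=> sA dA am; have [m0|m0] := posnP m.
  have no (j : 'I_m) : False by move: (ltn_ord j); rewrite [X in (_ < X)%N]m0.
  by exists 0, 0; split => //; try split; move=> *; exfalso; auto; apply: no.
apply: reduced_kkt.
- by apply: lt_le_trans am; rewrite mulr_gt0 ?ltr0n.
- apply/matrixP => i j; rewrite mxE !sdp_costE eq_sym; congr (_ - _).
  by rewrite -{1}sA mxE.
- by move=> j; rewrite sdp_costE eqxx dA subr0.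
Qed.

Section OutlierBlock.
Variables (m : nat) (alpha lambda : R) (A22 : 'M[R]_m).

Lemma sdp_cost_off j j' : 0 <= lambda <= 1 ->
  (forall j, A22 j j = 0) -> (forall j j', 0 <= A22 j j' <= 1) ->
  `|sdp_cost alpha lambda A22 j j' - (j == j')%:R * alpha| <= 1.
Proof.
move=> l01 dA A01; rewrite sdp_costE; case: eqP => [->|_] /=.
  by rewrite dA mul1r subr0 subrr normr0.
by rewrite mul0r subr0; have := A01 j j'; rewrite ler_norml; lra.
Qed.

(** By [sdp_cost_off] the outlier cost is alpha times the identity up to entries of size at most 1,
    and 2 |x y| <= x^2 + y^2 charges their total effect as m per coordinate. This bound makes the
    outlier block invertible and controls its inverse. *)
Lemma quad_outlier_ge (mu : 'rV[R]_m) (w : 'cV[R]_m) : 0 <= lambda <= 1 ->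
  (forall j, A22 j j = 0) -> (forall j j', 0 <= A22 j j' <= 1) ->
  \sum_j (alpha - m%:R + mu 0 j) * w j 0 ^+ 2 <=
  quad (sdp_cost alpha lambda A22 + diag_mx mu) w.
Proof.
move=> l01 dA A01.
have -> : \sum_j (alpha - m%:R + mu 0 j) * w j 0 ^+ 2 =
    \sum_j (alpha + mu 0 j) * w j 0 ^+ 2 - m%:R * sqn w.
  by rewrite /sqn mulr_sumr -sumrB; apply: eq_bigr => j _; ring.
have -> : quad (sdp_cost alpha lambda A22 + diag_mx mu) w =
  \sum_j (alpha + mu 0 j) * w j 0 ^+ 2 +
  \sum_i \sum_j w i 0 * (sdp_cost alpha lambda A22 i j - (i == j)%:R * alpha) * w j 0.
  rewrite quadE -big_split /=; apply: eq_bigr => i _.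
  have -> : (alpha + mu 0 i) * w i 0 ^+ 2 =
    \sum_j (i == j)%:R * ((alpha + mu 0 i) * w i 0 * w j 0).
    rewrite (bigD1 i) //= eqxx big1 ?addr0; first by rewrite /=; ring.
    by move=> j; rewrite eq_sym => /negbTE ->; rewrite mul0r.
  rewrite -big_split /=; apply: eq_bigr => j _; rewrite [in LHS]mxE [diag_mx _ _ _]mxE.
  by move: (sdp_cost _ _ _ _ _) => c; case: eqP => [<-|_]; rewrite ?mulr1n ?mulr0n; ring.
rewrite lerD2l lerNl.
have -> : m%:R * sqn w = \sum_(i < m) \sum_(j < m) (w i 0 ^+ 2 + w j 0 ^+ 2) / 2.
  under eq_bigr => i _ do rewrite -mulr_suml big_split /= sumr_const card_ord.
  rewrite -mulr_suml big_split /= sumrMnl sumr_const card_ord -/(sqn w) -mulr_natr.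
  by field.
rewrite -sumrN; apply: ler_sum => i _; rewrite -sumrN; apply: ler_sum => j _.
have := sdp_cost_off i j l01 dA A01; move: (_ - _) => c.
have := sqr_ge0 (w i 0 - w j 0); have := sqr_ge0 (w i 0 + w j 0).
move: (w i 0) (w j 0) => x y; rewrite ler_norml => ? ? /andP[? ?]; nra.
Qed.

Lemma mul_outlier_le r (Z : 'M[R]_(r, m)) (mu : 'rV[R]_m) k j : 0 <= lambda <= 1 ->
  (forall j, A22 j j = 0) -> (forall j j', 0 <= A22 j j' <= 1) ->
  (forall k j, 0 <= Z k j) -> (forall j, \sum_k Z k j ^+ 2 <= 1) ->
  (Z *m (sdp_cost alpha lambda A22 + diag_mx mu)) k j <=
  (alpha + mu 0 j) * Z k j + m%:R.
Proof.
move=> l01 dA A01 Z0 Z1.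
have Zle1 k' j' : Z k' j' <= 1.
  rewrite -(@expr_le1 _ 2) //; apply: le_trans (Z1 j').
  by rewrite (bigD1 k') //= lerDl sumr_ge0 // => *; exact: sqr_ge0.
rewrite mulmxDr mxE mul_mx_diag [X in _ + X]mxE mulrDl addrAC.
rewrite [mu 0 j * _]mulrC lerD2r mxE.
have -> : alpha * Z k j = \sum_j' Z k j' * ((j' == j)%:R * alpha).
  rewrite (bigD1 j) //= eqxx big1 ?addr0; first by rewrite /=; ring.
  by move=> j' /negbTE ->; rewrite mul0r mulr0.
have -> : m%:R = \sum_(j' < m) (1 : R) by rewrite sumr_const card_ord.
rewrite -big_split /=; apply: ler_sum => j' _.
have := sdp_cost_off j' j l01 dA A01.
move: (Zle1 k j') (Z0 k j'); rewrite ler_norml => z1 z0 /andP[_ c1].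
move: (sdp_cost _ _ _ _ _) ((j' == j)%:R * alpha) (Z k j') c1 z0 z1 => c e z *; nra.
Qed.
End OutlierBlock.

Lemma quad_block_ul n m (U : 'M[R]_n) (v : 'cV[R]_(n + m)) :
  quad (block_mx U 0 0 0) v = quad U (usubmx v).
Proof.
rewrite /quad -{1 2}[v]vsubmxK tr_col_mx mul_row_block mul_row_col.
by rewrite !mulmx0 !addr0 mul0mx addr0.
Qed.

Lemma sum_le_sqrt (I : finType) (z : I -> R) :
  \sum_i z i ^+ 2 <= 1 -> \sum_i z i <= Num.sqrt #|I|%:R.
Proof.
move=> z1; apply: (le_trans (ler_norm _)); rewrite -sqrtr_sqr ler_wsqrtr //.
have := cauchy_schwarz_sum z (fun=> 1).
rewrite (eq_bigr z) => [|i _]; last by rewrite mulr1.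
move=> /le_trans; apply; rewrite [X in _ * X](eq_bigr (fun=> 1)) => [|i _];
  last by rewrite expr1n.
by rewrite sumr_const ler_piMl.
Qed.

Lemma quad_diag n (d : 'rV[R]_n) v : quad (diag_mx d) v = \sum_i d 0 i * v i 0 ^+ 2.
Proof.
rewrite /quad mul_mx_diag mxE; apply: eq_bigr => i _.
by rewrite !mxE expr2 mulrA [d 0 i * _]mulrC.
Qed.

(** The deterministic core. The noise enters only through the row-sum and quadratic-form hypotheses
    on [W]; the outlier entries are arbitrary. The hypothesis with [a0 / (alpha - m)] says that the
    Schur complement is small on block-centered vectors. *)
Lemma sdp_inlier_block n m r (kap : 'I_n -> 'I_r) (A11 : 'M[R]_n)
    (A12 : 'M[R]_(n, m)) (A22 : 'M[R]_m) (B : 'M[R]_r)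
    (alpha lambda delta nm a0 : R) (X : 'M[R]_(n + m)) :
  let W : 'M[R]_n := A11 - \matrix_(i, a) (if i == a then 0 else B (kap i) (kap a)) in
  0 < nm -> m%:R <= nm -> (forall k, nm <= block_size kap k) ->
  A11^T = A11 ->
  (forall i j, 0 <= A12 i j <= 1) ->
  A22^T = A22 -> (forall j, A22 j j = 0) -> (forall j j', 0 <= A22 j j' <= 1) ->
  0 <= lambda <= 1 -> 3 * m%:R <= alpha -> 0 < delta ->
  B^T = B -> (forall k, B k k <= 1) ->
  (forall k, delta / 4 <= B k k - lambda) ->
  (forall k k', k != k' -> delta / 4 <= lambda - B k k') ->
  (forall i k, `|(W *m indmx kap) i k| <=
     (if kap i == k then B k k - lambda else delta) / 16 * block_size kap k) ->
  (forall u, quad W u <= \sum_i ((B (kap i) (kap i) - lambda) / 16 * block_size kap (kap i)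
     + delta * nm / 16) * u i 0 ^+ 2) ->
  1000 <= delta * nm -> 1000 * alpha <= delta * nm ->
  lambda * n%:R + r%:R * m%:R <= a0 ->
  m%:R * (a0 / (alpha - m%:R) + 2 * Num.sqrt r%:R) <= delta * nm / 32 ->
  sdp_solution (sdp_cost alpha lambda (block_mx A11 A12 A12^T A22)) X ->
  forall i a, X (lshift m i) (lshift m a) = (kap i == kap a)%:R.
Proof.
move=> W nm0 mnm lnm sA11 A12b sA22 dA22 A22b l01 am d0 sB B1 Bd Bo Wrow Wq d1 da ha0 hH.
rewrite sdp_cost_block.
set l := block_size kap in lnm Wrow Wq; set V : 'M[R]_(n, r) := indmx kap in Wrow.
have l0 k : 0 < l k by apply: lt_le_trans (lnm k).
set E11 := sdp_cost _ _ A11; set E12 := const_mx lambda - A12; set E22 := sdp_cost _ _ A22.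
pose Eb := V^T *m E12.
have [Z [mu [[Z0 Z1] mu0 mu1]]] := reduced_kkt_sdp lambda Eb sA22 dA22 am.
rewrite -/E22; set M := E22 + diag_mx mu => phi0 phiZ.
pose phi := Eb + Z *m M.
rewrite -/phi in phi0 phiZ.
(* [phi k j] is the slack of the constraint [Z k j >= 0]. Spreading it evenly over community k makes
   [F - E12] equal to - phi / l, which is nonpositive and vanishes wherever [Z] is positive;
   moreover V^T F = - Z M, the outlier half of S G = 0. *)
pose Y : 'M[R]_(r, m) := \matrix_(k, j) (lambda - phi k j / l k).
pose F := V *m Y - A12.
have EbE k j : Eb k j = lambda * l k - (V^T *m A12) k j.
  rewrite /Eb /E12 mulmxBr mxE [X in X + _]tr_indmx_mul [X in _ + X]mxE.
  by rewrite (eq_bigr (fun=> lambda)) ?sum_blk // => *; rewrite mxE.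
have VF : V^T *m F = - (Z *m M).
  apply/matrixP => k j; rewrite /F mulmxBr mulmxA tr_indmxK mul_diag_mx [LHS]mxE.
  rewrite [X in X + _]mxE [X in X * _]mxE [Y k j]mxE [X in _ + X]mxE [RHS]mxE.
  have -> : phi k j = Eb k j + (Z *m M) k j by rewrite mxE.
  by rewrite EbE -/l; field; exact: (lt0r_neq0 (l0 k)).
have m1 (j : 'I_m) : (1 : R) <= m%:R by rewrite ler1n; case: (m) j => [[]|].
have MT : M^T = M.
  rewrite /M linearD /= tr_diag_mx; congr (_ + _).
  apply/matrixP => i j; rewrite mxE !sdp_costE eq_sym; congr (_ - _).
  by rewrite -{1}sA22 mxE.
have qM (w : 'cV[R]_m) : \sum_j (alpha - m%:R + mu 0 j) * w j 0 ^+ 2 <= quad M w.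
  exact: quad_outlier_ge.
have D0 j : 0 < alpha - m%:R + mu 0 j by have := m1 j; have := mu0 j; clear m1; lra.
have Mu : M \in unitmx by apply: (posdef_unitmx D0).
have qM0 (w : 'cV[R]_m) : 0 <= quad M w.
  by apply: le_trans (qM w); apply: sumr_ge0 => j _; rewrite mulr_ge0 ?sqr_ge0 // ltW.
pose Q0 := F *m invmx M.
have Q0M : Q0 *m M = F by rewrite /Q0 mulmxKV.
(* H = F M^-1 F^T is the smallest upper left block that keeps the certificate positive semidefinite
   once [F] and [M] are fixed. *)
pose H := F *m Q0^T.
have HE : H = Q0 *m M *m Q0^T by rewrite Q0M.
have HT : H^T = H by rewrite HE (trmx_mul (Q0 *m M)) trmxK (trmx_mul Q0) MT mulmxA.
have QV : Q0^T *m V = - Z^T.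
  by apply: trmx_inj; rewrite trmx_mul trmxK /Q0 mulmxA VF mulNmx mulmxK // linearN /=
    trmxK.
have HV : H *m V = - (F *m Z^T) by rewrite /H -mulmxA QV mulmxN.
pose Rm := E11 - H.
have E11T : E11^T = E11.
  by apply/matrixP => i j; rewrite mxE !sdp_costE eq_sym -{1}sA11 mxE.
have RT : Rm^T = Rm by rewrite linearB /= HT E11T.
pose N := cenmx kap : 'M[R]_n.
have NT : N^T = N by exact: tr_cenmx.
(* Half of the gap. On block-centered vectors the Laplacian contributes nu times the block size,
   against the noise; in an off-diagonal entry of a block it costs only [nu], while centering gains
   about B k k - lambda. *)
pose nu k := (B k k - lambda) / 2.
pose S1 := N *m Rm *m N + lapmx kap nu.
have S1V : S1 *m V = 0.
  by rewrite mulmxDl -mulmxA cenmx_ind // mulmx0 lapmx_ind addr0.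
have S1T : S1^T = S1.
  by rewrite linearD /= !trmx_mul tr_lapmx RT tr_cenmx mulmxA.
pose S := block_mx (H + S1) F F^T M.
pose G := col_mx V Z^T.
have SG : S *m G = 0.
  rewrite /S /G mul_block_col mulmxDl HV S1V addr0 addNr.
  rewrite -[_ + _]trmxK linearD /= !trmx_mul !trmxK MT VF addNr trmx0.
  by rewrite col_mx0.
pose Xs := G *m G^T.
have XsE : Xs = block_mx (V *m V^T) (V *m Z) (V *m Z)^T (Z^T *m Z).
  by rewrite /Xs /G tr_col_mx mul_col_row !trmxK trmx_mul.
have E11E : E11 = V *m (\matrix_(k, a) (lambda - B k (kap a))) - W
    + diag_mx (\row_i (alpha - lambda + B (kap i) (kap i))).
  apply/matrixP => i a; rewrite sdp_costE [RHS]mxE [X in _ = X + _]mxE mul_indmx.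
  by rewrite !mxE; case: eqP => [->|_]; rewrite ?mulr1n ?mulr0n; ring.
pose Hb := m%:R * (a0 / (alpha - m%:R) + 2 * Num.sqrt r%:R).
have n_sum : \sum_k l k = n%:R.
  transitivity (\sum_(a < n) (1 : R)); last by rewrite sumr_const card_ord.
  rewrite (partition_big kap xpredT) //=; apply: eq_bigr => k _.
  by rewrite -[l k]mul1r -sum_blk.
(* Summing phi >= 0 over the communities bounds the degree of an outlier. A degree beyond [a0] and
   alpha sqrt r is possible only if the multiplier [mu 0 j] is large. *)
have deg j : \sum_i A12 i j <= a0 + (alpha + mu 0 j) * Num.sqrt r%:R.
  have -> : \sum_i A12 i j = \sum_k (V^T *m A12) k j.
    rewrite (partition_big kap xpredT) //=; apply: eq_bigr => k _.
    by rewrite tr_indmx_mul.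
  apply: (@le_trans _ _ (\sum_k (lambda * l k + ((alpha + mu 0 j) * Z k j + m%:R)))).
    apply: ler_sum => k _; have := phi0 k j; rewrite mxE EbE.
    have := mul_outlier_le alpha mu k j l01 dA22 A22b Z0 Z1; rewrite -/E22 -/M.
    by clear m1; lra.
  rewrite big_split big_split /= -!mulr_sumr n_sum sumr_const card_ord -mulr_natl.
  have := sum_le_sqrt (Z1 j); rewrite card_ord => hs.
  have : (alpha + mu 0 j) * \sum_k Z k j <= (alpha + mu 0 j) * Num.sqrt r%:R.
    by apply: ler_wpM2l => //; have := m1 j; have := mu0 j; clear m1; lra.
  by clear m1; lra.
have sr0 : 0 <= Num.sqrt r%:R :> R by exact: sqrtr_ge0.
have a00 : 0 <= a0.
  apply: le_trans ha0; case/andP: l01 => l00 _.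
  by rewrite addr_ge0 // mulr_ge0.
have quadH (u : 'cV[R]_n) : V^T *m u = 0 -> quad H u <= Hb * sqn u.
  move=> u0; pose x := Q0^T *m u; pose y : 'cV[R]_m := - (A12^T *m u).
  have Mx : M *m x = y.
    rewrite /x mulmxA -{1}MT -trmx_mul Q0M /F linearB /= trmx_mul mulmxBl.
    by rewrite -mulmxA u0 mulmx0 sub0r.
  have qx : quad H u = quad M x by rewrite HE quad_conj.
  have qxy : quad M x = \sum_j x j 0 * y j 0.
    by rewrite /quad -mulmxA Mx mxE; apply: eq_bigr => j _; rewrite mxE.
  pose D j := alpha - m%:R + mu 0 j.
  have D0' j : 0 < D j by exact: D0.
  (* Since M x = y, the form is the scalar product of x and y; splitting it with weights [D] returns
     at most half of the form itself, by [qM]. What remains compares the degrees with [D], and [deg]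
     makes the ratio uniform because alpha + mu <= 2 (alpha - m + mu). *)
  have amgm : quad M x <= quad M x / 2 + (\sum_j y j 0 ^+ 2 / D j) / 2.
    apply: (@le_trans _ _ ((\sum_j D j * x j 0 ^+ 2) / 2 + (\sum_j y j 0 ^+ 2 / D j) / 2)).
      rewrite qxy !mulr_suml -big_split /=; apply: ler_sum => j _.
      have := sqr_ge0 (D j * x j 0 - y j 0).
      have := D0' j; move: (D j) (x j 0) (y j 0) => d s t dp sq.
      have : 0 <= (d * s - t) ^+ 2 / (2 * d) by rewrite divr_ge0 // mulr_ge0 // ltW.
      have -> : (d * s - t) ^+ 2 / (2 * d) = d * s ^+ 2 / 2 + t ^+ 2 / d / 2 - s * t.
        by field; exact: lt0r_neq0.
      by clear; lra.
    by rewrite lerD2r ler_pM2r ?invr_gt0 // qM.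
  have yb : \sum_j y j 0 ^+ 2 / D j <= Hb * sqn u.
    rewrite /Hb -mulrA; apply: (@le_trans _ _ (\sum_(j < m) (a0 / (alpha - m%:R) +
      2 * Num.sqrt r%:R) * sqn u)); last first.
      by rewrite sumr_const card_ord -[_ *+ m]mulr_natl.
    apply: ler_sum => j _.
    have y2 : y j 0 ^+ 2 <= (\sum_i A12 i j) * sqn u.
      rewrite mxE sqrrN mxE.
      apply: (le_trans (cauchy_schwarz_sum _ _)); apply: ler_wpM2r; first exact: sqn_ge0.
      apply: ler_sum => i _; rewrite mxE expr2 ler_piMl //; by case/andP: (A12b i j).
    rewrite ler_pdivrMr // mulrAC; apply: (le_trans y2); apply: ler_wpM2r;
      first exact: sqn_ge0.
    apply: (le_trans (deg j)); rewrite /D.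
    have am1 : 0 < alpha - m%:R by have := m1 j; clear m1; lra.
    have -> : (a0 / (alpha - m%:R) + 2 * Num.sqrt r%:R) * (alpha - m%:R + mu 0 j) =
      a0 + a0 / (alpha - m%:R) * mu 0 j + 2 * (alpha - m%:R + mu 0 j) * Num.sqrt r%:R.
      by field; exact: lt0r_neq0.
    have p1 : 0 <= a0 / (alpha - m%:R) * mu 0 j by rewrite mulr_ge0 // divr_ge0 // ltW.
    have : (alpha + mu 0 j) * Num.sqrt r%:R <= 2 * (alpha - m%:R + mu 0 j) * Num.sqrt r%:R.
      by apply: ler_wpM2r => //; have := m1 j; have := mu0 j; clear m1; lra.
    by clear -p1; lra.
  by rewrite qx; move: amgm yb; clear; lra.
have psdS : psd S.
  split; first by rewrite /S tr_block_mx linearD /= HT S1T trmxK MT.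
  move=> v; rewrite -/(quad S v).
  (* Completing the square in the outlier coordinates leaves only [S1] to be examined. *)
  have -> : S = col_mx Q0 1%:M *m M *m (col_mx Q0 1%:M)^T + block_mx S1 0 0 0.
    rewrite mul_col_mx Q0M mul1mx tr_col_mx mul_col_row trmx1 !mulmx1 -/H.
    have -> : M *m Q0^T = F^T by rewrite -{1}MT -trmx_mul Q0M.
    by rewrite add_block_mx !addr0.
  rewrite quadD quad_conj quad_block_ul addr_ge0 //.
  set w := usubmx v.
  have u0 : V^T *m (N *m w) = 0 by rewrite mulmxA tr_indmx_cen // mul0mx.
  rewrite quadD (quad_cen w (tr_lapmx _ _) (lapmx_ind _ _)) -/N.
  have -> : quad (N *m Rm *m N) w = quad Rm (N *m w).
    by rewrite -{2}NT quad_conj NT.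
  move: (N *m w) u0 => u u0.
  rewrite quad_lapmx // quadD quadN E11E !quadD quadN quad_ind_eq0 // quad_diag add0r.
  have := quadH u u0; have := Wq u; rewrite /sqn mulr_sumr.
  set s1 := \sum_i _; set s2 := \sum_i _; set s3 := \sum_i _; set s4 := \sum_i _.
  move=> q1 q2.
  suff : s1 + s2 <= s3 + s4 by move: q1 q2; clear; lra.
  rewrite /s1 /s2 /s3 /s4 -!big_split /=; apply: ler_sum => i _.
  rewrite -!mulrDl; apply: ler_wpM2r; first exact: sqr_ge0.
  rewrite mxE; have gk := Bd (kap i).
  have gl : delta / 4 * nm <= (B (kap i) (kap i) - lambda) * l (kap i).
    apply: ler_pM => //; [by move: d0; clear; lra|exact: ltW].
  have al0 : 0 <= alpha by apply: le_trans am; rewrite mulr_ge0.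
  have : Hb <= delta * nm / 32 by [].
  have dn0 : 0 <= delta * nm by move: d1; clear; lra.
  move: dn0 gl al0 gk d0; rewrite /nu -/l; move: (Hb) (B _ _) (l _) => h b ll.
  by clear; lra.
have Zle1 k j : Z k j <= 1.
  rewrite -(@expr_le1 _ 2) //; apply: le_trans (Z1 j).
  by rewrite (bigD1 k) //= lerDl sumr_ge0 // => *; exact: sqr_ge0.
have VVE i a : (V *m V^T) i a = (kap i == kap a)%:R.
  by rewrite mul_indmx !mxE eq_sym.
have fXs : sdp_feasible Xs.
  split; first exact: psd_mul_tr.
  have b01 (b : bool) : (0 : R) <= b%:R <= 1 by case: b; rewrite ?lexx ?ler01.
  have ZZ j j' : 0 <= (Z^T *m Z) j j' <= 1.
    rewrite mxE sumr_ge0 /= => [|k _]; last by rewrite mxE mulr_ge0.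
    apply: (@le_trans _ _ (\sum_k (Z k j ^+ 2 + Z k j' ^+ 2) / 2)).
      apply: ler_sum => k _; rewrite mxE; have := sqr_ge0 (Z k j - Z k j').
      by clear; lra.
    by rewrite -mulr_suml big_split /=; have := Z1 j; have := Z1 j'; clear; lra.
  move=> i j; rewrite XsE.
  case: (split_ordP i) => i' ->; case: (split_ordP j) => j' ->;
  rewrite ?block_mxEul ?block_mxEur ?block_mxEdl ?block_mxEdr.
  - by rewrite VVE b01.
  - by rewrite mul_indmx Z0 Zle1.
  - by rewrite mxE mul_indmx Z0 Zle1.
  - exact: ZZ.
(* Expected block mean of a row of [Rm], and below it the tolerance [e]: the noise, plus at most 2
   per outlier coming from F Z^T. Centering triples the tolerance, and 3/16 stays below both the
   half gap left by [nu] and the quarter of delta available between communities. *)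
pose x k k' := lambda - B k k' + (k == k')%:R * ((alpha - lambda + B k k) / l k').
pose e k k' := (if k == k' then B k k - lambda else delta) / 16 + 2 * m%:R / nm.
have row b k : `|(Rm *m V) b k / l k - x (kap b) k| <= e (kap b) k.
  have -> : (Rm *m V) b k = (lambda - B (kap b) k) * l k - (W *m V) b k
      + (alpha - lambda + B (kap b) (kap b)) * (kap b == k)%:R + (F *m Z^T) b k.
    rewrite /Rm mulmxBl HV opprK E11E mulmxDl mulmxBl -mulmxA mul_diag_mx.
    have subE (U1 U2 U3 U4 : 'M[R]_(n, r)) :
      (U1 - U2 + U3 + U4) b k = U1 b k - U2 b k + U3 b k + U4 b k by rewrite !mxE.
    rewrite subE mul_indmx mulmx_ind; congr (_ - _ + _ + _); last by rewrite !mxE.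
    by under eq_bigr => a /eqP ak do rewrite mxE ak; rewrite sum_blk.
  have FZ : `|(F *m Z^T) b k / l k| <= 2 * m%:R / nm.
    rewrite normrM [`|(l k)^-1|]gtr0_norm ?invr_gt0 //.
    apply: ler_pM; rewrite ?normr_ge0 ?invr_ge0 ?(ltW (l0 k)) //; last first.
      by rewrite lef_pV2 // posrE.
    rewrite mxE; apply: (le_trans (ler_norm_sum _ _ _)).
    have -> : 2 * m%:R = \sum_(j < m) (2 : R) by rewrite sumr_const card_ord mulr_natr.
    apply: ler_sum => j _; rewrite [_^T _ _]mxE normrM.
    rewrite -[leRHS]mulr1; apply: ler_pM; rewrite ?normr_ge0 //; last first.
      by rewrite ger0_norm.
    have FE : F b j = lambda - phi (kap b) j / l (kap b) - A12 b j.
      by rewrite mxE mul_indmx !mxE.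
    have : phi (kap b) j <= lambda * l (kap b) + m%:R.
      have [z0|/phiZ ->] := eqVneq (Z (kap b) j) 0; last first.
        by rewrite addr_ge0 // mulr_ge0 ?(ltW (l0 _)) //; case/andP: l01.
      rewrite mxE EbE.
      have := mul_outlier_le alpha mu (kap b) j l01 dA22 A22b Z0 Z1.
      rewrite -/E22 -/M z0 mulr0 add0r.
      have : 0 <= (V^T *m A12) (kap b) j.
        by rewrite tr_indmx_mul sumr_ge0 // => q _; case/andP: (A12b q j).
      by clear m1; lra.
    move: (phi0 (kap b) j) => p0 p1.
    have p2 : phi (kap b) j / l (kap b) <= lambda + 1.
      rewrite ler_pdivrMr // mulrDl mul1r; apply: (le_trans p1); rewrite lerD2l.
      exact: le_trans mnm (lnm _).
    have p3 : 0 <= phi (kap b) j / l (kap b) by rewrite divr_ge0 // ltW.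
    move: (A12b b j) l01 p2 p3; rewrite FE ler_norml.
    by move: (_ / l _) => q; clear; lra.
  have WV : `|(W *m V) b k / l k| <= (if kap b == k then B k k - lambda else delta) / 16.
    by rewrite normrM [`|(l k)^-1|]gtr0_norm ?invr_gt0 // ler_pdivrMr.
  have lk := lt0r_neq0 (l0 k).
  rewrite /x /e; move: WV FZ; have [->|_] := eqVneq (kap b) k.
    set w := (W *m V) b k; set f := (F *m Z^T) b k; rewrite mulr1 mul1r.
    have -> : ((lambda - B k k) * l k - w + (alpha - lambda + B k k) + f) / l k
       - (lambda - B k k + (alpha - lambda + B k k) / l k) = f / l k - w / l k.
      by field.
    rewrite !ler_norml; clear; lra.
  set w := (W *m V) b k; set f := (F *m Z^T) b k; rewrite mulr0 mul0r !addr0.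
  have -> : ((lambda - B (kap b) k) * l k - w + f) / l k
     - (lambda - B (kap b) k) = f / l k - w / l k.
    by field.
  rewrite !ler_norml; clear; lra.
have T11 i a : (H + S1 - E11) i a = lapmx kap nu i a - (Rm - N *m Rm *m N) i a.
  rewrite /S1 /Rm; move: (N *m _ *m N) (lapmx kap nu) => U L.
  by rewrite !mxE; ring.
have mnm1 : 2 * m%:R / nm <= delta / 1000.
  by rewrite ler_pdivrMr //; move: am da (ler0n R m); clear; lra.
have xsym k k' : x k' k = x k k'.
  rewrite /x eq_sym; have [->//|_] := eqVneq k k'.
  by rewrite !mul0r -{1}sB mxE.
have esym k k' : e k' k = e k k'.
  by rewrite /e eq_sym; case: eqVneq => [->|].
have T11b i a : `|(Rm - N *m Rm *m N) i a - x (kap i) (kap a)| <= 3 * e (kap i) (kap a).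
  apply: sub_cen_conjE => // b kb; first by rewrite -kb; exact: row.
  by rewrite -kb xsym esym; exact: row.
have T11same i a : kap i = kap a -> 0 < (H + S1 - E11) i a.
  move=> ia; rewrite T11 mxE ia eqxx.
  have := T11b i a; rewrite ia /x /e eqxx mul1r ler_norml => /andP[_].
  have nu0 : 0 <= nu (kap a) * ((i == a)%:R * l (kap a)).
    rewrite /nu mulr_ge0 ?divr_ge0 // ?mulr_ge0 // ?(ltW (l0 _)) //.
    by have := Bd (kap a); move: d0; clear; lra.
  have hx : (alpha - lambda + B (kap a) (kap a)) / l (kap a) <= 2 * delta / 1000.
    rewrite ler_pdivrMr //.
    have : delta * nm <= delta * l (kap a) by rewrite ler_pM2l.
    have := B1 (kap a); case/andP: l01; move: da d1; clear; lra.
  have gk := Bd (kap a).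
  move: nu0 hx gk mnm1 d0; rewrite mulrBr mulr1 -/l /nu.
  by clear; lra.
have T11diff i a : kap i != kap a -> (H + S1 - E11) i a < 0.
  move=> ia; rewrite T11 mxE (negbTE ia).
  have := T11b i a; rewrite /x /e (negbTE ia) mul0r ler_norml => /andP[+ _].
  have gk := Bo _ _ ia.
  by move: gk mnm1 d0; clear; lra.
move=> solX i a.
have SE : S - block_mx E11 E12 E12^T E22 =
    block_mx (H + S1 - E11) (F - E12) (F - E12)^T (diag_mx mu).
  have -> : diag_mx mu = M - E22 by rewrite /M addrC addKr.
  rewrite /S opp_block_mx add_block_mx. by rewrite [(F - E12)^T]linearB.
have FE i' j : (F - E12) i' j = - (phi (kap i') j / l (kap i')).
  rewrite mxE [F i' j]mxE mul_indmx !mxE; ring.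
have ur Y' i' j : sdp_feasible Y' ->
    0 <= (Z (kap i') j - Y' (lshift m i') (rshift n j)) * (F - E12) i' j.
  move=> [_ fY]; rewrite FE; have [z0|z0] := eqVneq (Z (kap i') j) 0.
    rewrite z0 sub0r mulrNN mulr_ge0 ?divr_ge0 // ?(ltW (l0 _)) //.
    by case/andP: (fY (lshift m i') (rshift n j)).
  by rewrite phiZ // mul0r oppr0 mulr0.
have sgn Y' : sdp_feasible Y' -> forall i j,
    0 <= (Xs i j - Y' i j) * (S - block_mx E11 E12 E12^T E22) i j.
  move=> fY i0 j0; rewrite SE XsE; have fY' := fY.2; have sY := fY.1.1.
  case: (split_ordP i0) => i' ->; case: (split_ordP j0) => j' ->;
  rewrite ?block_mxEul ?block_mxEur ?block_mxEdl ?block_mxEdr ?VVE.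
  - have /andP[y0 y1] := fY' (lshift m i') (lshift m j').
    have [/T11same t|/T11diff t] := eqVneq (kap i') (kap j').
      by rewrite mulr_ge0 ?subr_ge0 // ltW.
    by rewrite sub0r mulNr oppr_ge0 mulr_ge0_le0 // ltW.
  - by rewrite mul_indmx; exact: ur.
  - by rewrite mxE [(F - E12)^T _ _]mxE mul_indmx -sY mxE; exact: ur.
  (* A nonzero [mu] means that the outlier vector has norm 1, so the diagonal entry of [Xs] has its
     largest feasible value. *)
  - rewrite mxE [X in _ * X]mxE; case: eqP => [->|_]; last by rewrite mulr0n mulr0.
    rewrite mulr1n; have [->|/mu1 m1'] := eqVneq (mu 0 j') 0; first by rewrite mulr0.
    rewrite (eq_bigr (fun k => Z k j' ^+ 2)) ?m1' => [|k _]; last by rewrite mxE.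
    by rewrite mulr_ge0 // subr_ge0; case/andP: (fY' (rshift n j') (rshift n j')).
have SXs : S *m Xs = 0 by rewrite /Xs mulmxA SG mul0mx.
rewrite (sdp_solution_unique fXs psdS SXs sgn solX); first by rewrite XsE block_mxEul VVE.
rewrite SE block_mxEul; have [/T11same t|/T11diff t] := eqVneq (kap i) (kap a).
  by rewrite gt_eqF.
by rewrite lt_eqF.
Qed.

End Certificate.

(** * Exact k-means *)

Section KMeans.
Context {R : realType}.

Lemma norm2_sqr N (x : 'cV[R]_N) : norm2 x ^+ 2 = sqn x.
Proof. by rewrite sqr_sqrtr // sqn_ge0. Qed.

Lemma sqn_gt0 N (x : 'cV[R]_N) : x != 0 -> 0 < sqn x.
Proof.
move=> x0; rewrite lt_def sqn_ge0 andbT; apply: contra x0.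
rewrite psumr_eq0 => [/allP h|i _]; last exact: sqr_ge0.
apply/eqP/colP => i; rewrite mxE; have := h i; rewrite mem_index_enum => /(_ isT).
by rewrite sqrf_eq0 => /eqP.
Qed.

Lemma kmeans_costE N r (y : 'I_N -> 'cV[R]_N) (f : 'I_N -> 'I_r) mu :
  kmeans_cost y f mu = \sum_j sqn (y j - mu (f j)).
Proof.
rewrite (partition_big f xpredT) //=; apply: eq_bigr => k _.
by apply: eq_bigr => j /eqP ->; rewrite norm2_sqr.
Qed.

Lemma sqn_sub N (x z : 'cV[R]_N) :
  sqn (x - z) = sqn x + sqn z - 2 * (x^T *m z) 0 0.
Proof.
rewrite /sqn mxE mulr_sumr -big_split -sumrB /=; apply: eq_bigr => i _.
by rewrite !mxE; ring.
Qed.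

(** The midpoint is the cheapest common center, and it gives equality. *)
Lemma sqn_parallelogram N (x z c : 'cV[R]_N) :
  sqn (x - z) / 2 <= sqn (x - c) + sqn (z - c).
Proof.
rewrite /sqn mulr_suml -big_split /=; apply: ler_sum => i _; rewrite !mxE.
move: (x i 0) (z i 0) (c i 0) => a b d.
by have := sqr_ge0 (a + b - 2 * d); clear; nra.
Qed.

Lemma ler_sum_uniq (I : finType) (s : seq I) (F : I -> R) :
  uniq s -> (forall i, 0 <= F i) -> \sum_(i <- s) F i <= \sum_i F i.
Proof.
move=> us F0; rewrite big_uniq // [leRHS](bigID (fun i => i \in s)) /=.
by rewrite lerDl sumr_ge0.
Qed.

(* Equality in the 2x2 minor forces equal columns. *)
Lemma psd_col_eq N (X : 'M[R]_N) u v t : psd X ->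
  X u u = 1 -> X v v = 1 -> X u v = 1 -> X t u = X t v.
Proof.
move=> [sX pX] uu vv uv.
have vu : X v u = 1 by rewrite -sX mxE.
pose d := X t u - X t v.
have q (s : R) : 0 <= s ^+ 2 * X t t + 2 * s * d.
  have := pX (s *: delta_mx t 0 + (delta_mx u 0 - delta_mx v 0)).
  have trE (a b c : 'cV[R]_N) : (s *: a + (b - c))^T = s *: a^T + (b^T - c^T).
    by apply/matrixP => i j; rewrite !mxE.
  rewrite trE !trmx_delta !(mulmxDl, mulmxDr, mulNmx, mulmxN) -!(scalemxAl, scalemxAr).
  have ut : X u t = X t u by rewrite -{1}sX mxE.
  have vt : X v t = X t v by rewrite -{1}sX mxE.
  have dE' a b : delta_mx 0 a *m X *m delta_mx b 0 = (X a b)%:M :> 'M[R]_1.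
    apply/matrixP => i j; rewrite !ord1 [RHS]mxE eqxx mulr1n.
    by rewrite -rowE -colE !mxE.
  rewrite !dE'. rewrite !mxE eqxx !mulr1n uu vv uv vu ut vt /d /=.
  by clear; lra.
apply/eqP; rewrite -subr_eq0 -/d; apply/negPn/negP => d0.
(* The minimizer of the quadratic in s would be - d / X t t; the enlarged denominator cannot vanish
   and still makes the value negative when d != 0. *)
have := q (- d / (1 + `|X t t|)).
have x1 : 0 < 1 + `|X t t| by have := normr_ge0 (X t t); clear; lra.
have -> : (- d / (1 + `|X t t|)) ^+ 2 * X t t + 2 * (- d / (1 + `|X t t|)) * d =
   d ^+ 2 / (1 + `|X t t|) ^+ 2 * (X t t - 2 * (1 + `|X t t|)).
  by field; exact: lt0r_neq0.
rewrite pmulr_rge0; last by apply: divr_gt0; rewrite exprn_even_gt0 //= ?d0 // gt_eqF.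
by have := ler_norm (X t t); move: x1; clear; lra.
Qed.

Lemma kmeans_pairs N r (phi : 'I_N -> nat) (X : 'M[R]_N) (y : 'I_N -> 'cV[R]_N)
    (f : 'I_N -> 'I_r) (m nm : R) p :
  sdp_feasible X ->
  (forall u v, (phi u < r)%N -> (phi v < r)%N -> X u v = (phi u == phi v)%:R) ->
  #|[set u | (r <= phi u)%N]|%:R <= m ->
  (forall u, (phi u < r)%N -> nm <= #|[set v | phi v == phi u]|%:R) ->
  (2 <= r)%N -> m < nm / (2 * r%:R + 4) ->
  normalized_columns X y -> kmeans_solution y f ->
  misclassified_pairs phi f p -> p%:R <= (2 * r%:R + 3) * m.
Proof.
move=> fX Xin outm nmin r2 mnm ny [mu muopt].
have [pX X01] := fX; have sX := pX.1.
have m0 : 0 <= m by apply: le_trans outm.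
have r4 : 8 <= 2 * r%:R + 4 :> R.
  have : 2 <= r%:R :> R by rewrite ler_nat.
  by clear; lra.
have nm0 : 0 < nm.
  have : 0 < nm / (2 * r%:R + 4) by apply: le_lt_trans mnm.
  by rewrite pmulr_lgt0 // invr_gt0; move: r4; clear; lra.
have y1 u : sqn (y u) = 1.
  have := ny u; case: ifP => [x0 ->|_ [h _]]; last by rewrite -norm2_sqr h expr1n.
  have n0 : sqn (col u X) != 0 by rewrite gt_eqF // sqn_gt0.
  rewrite /sqn; under eq_bigr => i _ do rewrite mxE exprMn.
  by rewrite -mulr_sumr exprVn norm2_sqr mulVf.
have y0 u k : 0 <= y u k 0.
  have := ny u; case: ifP => [x0 ->|_ [_ h]]; last exact: h.
  by rewrite !mxE mulr_ge0 ?invr_ge0 ?sqrtr_ge0 //; case/andP: (X01 k u).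
have same u v : (phi u < r)%N -> phi u = phi v -> y u = y v.
  move=> ur uv; have vr : (phi v < r)%N by rewrite -uv.
  have cE : col u X = col v X.
    apply/colP => t; rewrite !mxE; apply: psd_col_eq => //;
    by rewrite Xin // ?uv eqxx.
  have c0 : col v X != 0.
    apply/eqP => /colP/(_ v); rewrite !mxE Xin // eqxx => /eqP.
    by rewrite oner_eq0.
  by have := ny u; have := ny v; rewrite cE c0 => -> ->.
have inl u : (phi u < r)%N -> col u X != 0 /\ nm <= sqn (col u X).
  move=> ur; have c : nm <= sqn (col u X).
    apply: (le_trans (nmin u ur)); rewrite -sum1_card natr_sum big_mkcond /=.
    apply: ler_sum => v _; rewrite inE mxE; case: eqP => [vu|_]; last exact: sqr_ge0.
    by rewrite Xin ?vu // eqxx expr1n.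
  split => //; apply/eqP => c0; move: c; rewrite c0 /sqn big1 => [|i _].
    by rewrite leNgt nm0.
  by rewrite mxE expr0n.
have diff u v : (phi u < r)%N -> (phi v < r)%N -> phi u != phi v ->
    ((y u)^T *m y v) 0 0 <= m / nm.
  move=> ur vr uv; have [cu su] := inl u ur; have [cv sv] := inl v vr.
  have := ny u; have := ny v; rewrite cu cv => -> ->.
  have trZ c (a : 'cV[R]_N) : (c *: a)^T = c *: a^T.
    by apply/matrixP => i j; rewrite !mxE.
  rewrite trZ -scalemxAl -scalemxAr !mxE /=.
  (* An inlier row lies in at most one of the two communities, so its product is 0; only outlier
     rows contribute, each at most 1. *)
  have dot : \sum_j (col u X)^T 0 j * col v X j 0 <= m.
    apply: le_trans outm; rewrite -sum1_card natr_sum [leRHS]big_mkcond /=.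
    apply: ler_sum => t _; rewrite inE !mxE.
    have [/andP[a0 a1] /andP[b0 b1]] := (X01 t u, X01 t v).
    case: leqP => tr; first by rewrite -[leRHS]mulr1; apply: ler_pM.
    rewrite !Xin //; case: eqP => [->|_]; last by rewrite mul0r.
    by rewrite (negbTE uv) mulr0.
  have d0 : 0 <= \sum_j (col u X)^T 0 j * col v X j 0.
    by apply: sumr_ge0 => t _; rewrite !mxE mulr_ge0 //;
      [case/andP: (X01 t u)|case/andP: (X01 t v)].
  have nn : nm <= norm2 (col u X) * norm2 (col v X).
    rewrite /norm2 -sqrtrM ?sqn_ge0 // -[nm]ger0_norm ?(ltW nm0) // -sqrtr_sqr.
    by rewrite ler_wsqrtr // expr2; apply: ler_pM => //; exact: ltW.
  rewrite mulrA -invfM mulrC; apply: ler_pM => //.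
    by rewrite invr_ge0 mulr_ge0 // sqrtr_ge0.
  by rewrite lef_pV2 // posrE; exact: lt_le_trans nm0 nn.
case/existsP => a /existsP[b /andP[uab /forallP ab]].
pose F u := sqn (y u - mu (f u)).
have F0 u : 0 <= F u by exact: sqn_ge0.
have low : p%:R * (1 - m / nm) <= kmeans_cost y f mu.
  rewrite kmeans_costE; apply: le_trans (ler_sum_uniq uab F0).
  rewrite big_cat /= !big_tuple -big_split /=.
  have -> : p%:R * (1 - m / nm) = \sum_(j < p) (1 - m / nm).
    by rewrite sumr_const card_ord mulr_natl.
  apply: ler_sum => j _; have /and3P[ltab br /eqP fab] := ab j.
  have ar := ltn_trans ltab br.
  rewrite /F fab; apply: le_trans (sqn_parallelogram _ _ _).
  have := diff _ _ ar br; rewrite neq_ltn ltab => /(_ isT).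
  by rewrite sqn_sub !y1; clear; lra.
have r0 : (0 < r)%N by exact: ltn_trans r2.
(* The competitor: inliers follow their community, outliers go to the default cluster 0. Every
   center is the vector of some node of that community, so an inlier costs 0 and an outlier at most
   2, since the scalar product of nonnegative vectors is nonnegative. *)
pose f' u := insubd (Ordinal r0) (phi u).
pose mu' (k : 'I_r) := if [pick u | phi u == k] is Some u then y u else 0.
have up : kmeans_cost y f' mu' <= 2 * m.
  rewrite kmeans_costE.
  apply: (@le_trans _ _ (\sum_u (if u \in [set u | (r <= phi u)%N] then 2 else 0))).
    apply: ler_sum => u _; rewrite inE; case: leqP => ur.
      rewrite /mu'; case: pickP => [v _|_]; last first.
        by rewrite subr0 y1; clear; lra.
      rewrite sqn_sub !y1.
      have : 0 <= ((y u)^T *m y v) 0 0.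
        by rewrite mxE sumr_ge0 // => i _; rewrite mxE mulr_ge0.
      by clear; lra.
    have fu : f' u = phi u :> nat by rewrite /f' val_insubd ur.
    rewrite /mu'; case: pickP => [v /eqP|/(_ u)]; last by rewrite fu eqxx.
    rewrite fu => vu; rewrite (same u v ur (esym vu)) subrr /sqn big1 // => i _.
    by rewrite mxE expr0n.
  by rewrite -big_mkcond /= sumr_const -[leLHS]mulr_natr ler_pM2l.
have := le_trans low (le_trans (muopt f' mu') up).
set t := 2 * r%:R + 4 in r4 mnm *.
have t0 : 0 < t by move: r4; clear; lra.
have mt : m / nm <= 1 / t.
  rewrite ler_pdivrMr // mul1r mulrC; exact: ltW.
have -> : 2 * r%:R + 3 = t - 1 by rewrite /t; ring.
move=> h; have p0 : 0 <= p%:R :> R by rewrite ler0n.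
have h1 : p%:R * (1 - 1 / t) <= 2 * m.
  by apply: le_trans h; apply: ler_wpM2l => //; move: mt; clear; lra.
have h2 : p%:R * (t - 1) <= 2 * m * t.
  have -> : p%:R * (t - 1) = p%:R * (1 - 1 / t) * t by field; exact: lt0r_neq0.
  by rewrite ler_pM2r.
have t1 : 0 < t - 1 by move: r4; clear; lra.
rewrite -(ler_pM2r t1); apply: (le_trans h2).
(* The inequality 2 t <= (t - 1)^2, with t^2 - 4 t + 1 expanded around 8; t >= 8 because r >= 2. *)
have : 0 <= m * ((t - 8) * (t - 8) + 12 * (t - 8) + 33).
  by rewrite mulr_ge0 // addr_ge0 // addr_ge0 ?mulr_ge0 // subr_ge0.
by clear; lra.
Qed.

Lemma misclassification_rate_le N r n (phi : 'I_N -> nat) (f : 'I_N -> 'I_r) (c : R) :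
  0 <= c ->
  (forall p, misclassified_pairs phi f p -> p%:R <= c) ->
  misclassification_rate R n phi f <= c / n%:R.
Proof.
move=> c0 h; rewrite /misclassification_rate ler_wpM2r // ?invr_ge0 //.
elim/big_ind: _ => // [a b ha hb|p]; last exact: h.
by rewrite /maxn; case: ifP.
Qed.

End KMeans.

(** * Concentration of the inlier noise *)

Section Tails.
Context {R : realType}.

(** From exp (- x) >= 1 - x one gets exp x <= 1 / (1 - x), and (1 - x) (1 + x + 2 x^2) = 1 + x^2 (1
    - 2 x). *)
Lemma expR_le_quadratic (x : R) : `|x| <= 1 / 2 -> expR x <= 1 + x + 2 * x ^+ 2.
Proof.
rewrite ler_norml => /andP[x1 x2].
have e0 := expR_gt0 x; have := expR_ge1Dx (- x); rewrite expRN => h.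
have h2 : (1 - x) * expR x <= 1.
  by rewrite -ler_pdivlMr // mul1r.
have x3 : 0 < 1 - x by lra.
rewrite -(ler_pM2l x3); apply: (le_trans h2).
have : 0 <= x ^+ 2 * (1 - 2 * x) by rewrite mulr_ge0 ?sqr_ge0 //; lra.
lra.
Qed.

(** The linear terms cancel and the quadratic ones add up to 2 theta^2 p (1 - p). The form [0 - p]
    matches [noise] at [false]. *)
Lemma bernoulli_mgf_le (p theta : R) : 0 <= p <= 1 -> `|theta| <= 1 / 2 ->
  p * expR (theta * (1 - p)) + (1 - p) * expR (theta * (0 - p)) <=
  expR (2 * theta ^+ 2 * p).
Proof.
move=> /andP[p0 p1] th.
have le1 (c : R) : `|c| <= 1 -> `|theta * c| <= 1 / 2.
  by move=> c1; rewrite normrM -[leRHS]mulr1; apply: ler_pM.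
have h1 := expR_le_quadratic (le1 (1 - p) _).
have h2 := expR_le_quadratic (le1 (0 - p) _).
have {}h1 := h1 ltac:(by rewrite ler_norml; lra).
have {}h2 := h2 ltac:(by rewrite ler_norml; lra).
apply: le_trans (expR_ge1Dx _).
have p1' : 0 <= 1 - p by lra.
have := ler_wpM2l p0 h1; have := ler_wpM2l p1' h2.
have : 0 <= theta ^+ 2 * p ^+ 2 by rewrite mulr_ge0 // sqr_ge0.
move: (expR _) (expR _) => a b; nra.
Qed.

Variables (E : finType) (pr : E -> R).

Lemma bern_expect_expR_noise_le (c : pred E) (v : E -> R) (theta : R) :
  (forall e, 0 <= pr e <= 1) -> (forall e, c e -> pr e <= v e) -> `|theta| <= 1 / 2 ->
  bern_expect pr (fun b => expR (theta * \sum_e noise pr c e (b e))) <=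
  expR (2 * theta ^+ 2 * \sum_(e | c e) v e).
Proof.
move=> pr01 cv th.
under eq_bern_expect => b do rewrite mulr_sumr expR_sum.
rewrite (bern_expect_prod pr (fun e b => expR (theta * noise pr c e b))).
rewrite [X in _ * X]big_mkcond mulr_sumr expR_sum; apply: ler_prod => e _.
have /andP[p0 p1] := pr01 e.
rewrite addr_ge0 ?mulr_ge0 ?expR_ge0 ?subr_ge0 //=.
rewrite /noise; case ce : (c e) => /=; last first.
  by rewrite !mul0r !mulr0 expR0 !mulr1 addrC subrK.
rewrite mulr1n !mul1r.
apply: (le_trans (bernoulli_mgf_le (pr01 e) th)).
rewrite ler_expR; apply: ler_wpM2l; last exact: cv.
by rewrite mulr_ge0 // sqr_ge0.
Qed.

(** Chernoff bound for both signs at once: the indicator is at most exp (- theta t) times the sum of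
    the two exponentials. The parameter theta is left to the caller. *)
Lemma bern_expect_noise_tail (c : pred E) (v : E -> R) (theta t a : R) :
  (forall e, 0 <= pr e <= 1) -> (forall e, c e -> pr e <= v e) ->
  0 <= theta <= 1 / 2 -> \sum_(e | c e) v e <= a ->
  bern_expect pr (fun b => (t < `|\sum_e noise pr c e (b e)|)%R%:R) <=
  2 * expR (2 * theta ^+ 2 * a - theta * t).
Proof.
move=> pr01 cv /andP[th0 th1] va.
have tN (s : R) : `|s| = theta ->
  bern_expect pr (fun b => expR (s * \sum_e noise pr c e (b e))) <=
    expR (2 * theta ^+ 2 * a).
  move=> s1; apply: (le_trans (bern_expect_expR_noise_le pr01 cv _)); first by rewrite s1.
  by rewrite ler_expR -s1 real_normK ?num_real // ler_wpM2l // mulr_ge0 // sqr_ge0.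
have h1 := tN theta (ger0_norm th0); have h2 := tN (- theta).
have {}h2 := h2 ltac:(by rewrite normrN ger0_norm).
apply: (@le_trans _ _ (bern_expect pr (fun b => expR (- (theta * t)) *
  (expR (theta * \sum_e noise pr c e (b e)) +
    expR (- theta * \sum_e noise pr c e (b e)))))).
  apply: ler_bern_expect => // b; move: (\sum_e _) => s.
  case: ltP => ts /=; last by rewrite mulr_ge0 ?addr_ge0 ?expR_ge0.
  rewrite mulrDr -!expRD.
  have [s0|s0] := leP 0 s.
    rewrite ger0_norm // in ts; apply: (@le_trans _ _ (expR (- (theta * t) + theta * s))).
      by rewrite -expR0 ler_expR addrC subr_ge0 ler_wpM2l // ltW.
    by rewrite lerDl expR_ge0.
  rewrite ltr0_norm // in ts; apply: (@le_trans _ _ (expR (- (theta * t) + - theta * s))).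
    by rewrite -expR0 ler_expR addrC mulNr -mulrN subr_ge0 ler_wpM2l // ltW.
  by rewrite lerDr expR_ge0.
rewrite bern_expectZ bern_expectD expRD mulrC.
apply: (@le_trans _ _ ((expR (2 * theta ^+ 2 * a) +
  expR (2 * theta ^+ 2 * a)) * expR (- (theta * t)))).
  by apply: ler_wpM2r; [exact: expR_ge0|exact: lerD].
rewrite -mulrA; move: (expR _) (expR _) => x y; lra.
Qed.

(** Markov's inequality for the trace of the power 2k, k = 2^j: a large value of the form forces a
    large trace by [quad_le_mxtrace_pow]. The factor 64 in the hypothesis is the gain per power. *)
Lemma bern_expect_quad_tail (c : pred E) n (ed : 'I_n -> 'I_n -> option E) (v : E ->
  R) (a t : R) j :
  (forall e, 0 <= pr e <= 1) ->
  (forall i j j' e, ed i j = Some e -> ed i j' = Some e -> j = j') ->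
  (forall i j, ed i j = ed j i) ->
  (forall e, c e -> pr e <= v e) -> (forall e, 0 <= v e) ->
  (forall i, \sum_j oapp v 0 (ed i j) <= a) ->
  0 <= a -> 0 < t -> 64 * (9 * (2 ^ j)%:R * (a + (2 ^ j)%:R)) <= t ^+ 2 ->
  bern_expect pr (fun b => `[< exists u, t * sqn u < quad (noise_mx pr c ed b) u >]%:R) <=
  n%:R / 64 ^+ (2 ^ j).
Proof.
move=> pr01 edi eds cv v0 va a0 t0 ht.
set k := (2 ^ j)%N in ht *.
have k0 : (0 < k)%N by rewrite expn_gt0.
have k2 : (2 ^ j.+1 = k.*2)%N by rewrite expnS mul2n.
have WT b : (noise_mx pr c ed b)^T = noise_mx pr c ed b.
  by apply/matrixP => i i'; rewrite !mxE eds.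
apply: (@le_trans _ _ (bern_expect pr (fun b => t ^- k.*2 * \tr (noise_mx pr c ed b ^+
  k.*2)))).
  apply: ler_bern_expect => // b.
  have tr0 : 0 <= \tr (noise_mx pr c ed b ^+ k.*2).
    rewrite -mul2n mulnC exprM mxtrace_sqr; last exact: trmx_pow.
    by apply: sumr_ge0 => i _; apply: sumr_ge0 => ? _; exact: sqr_ge0.
  case: asboolP => [[u hu]|_] /=; last by rewrite mulr_ge0 ?invr_ge0 ?exprn_ge0 // ltW.
  rewrite ler_pdivlMl ?exprn_gt0 // mulr1 leNgt; apply/negP => trt.
  move: hu; rewrite ltNge => /negP; apply.
  by apply: (@quad_le_mxtrace_pow _ _ _ j) => //; rewrite ?k2 ltW.
rewrite bern_expectZ ler_pdivrMl ?exprn_gt0 //.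
apply: (le_trans (bern_expect_trace_noise_mx_le pr01 edi cv v0 va k0)).
rewrite mulrCA ler_wpM2l // ler_pdivlMr ?exprn_gt0 //.
rewrite -mul2n exprM -exprMn; apply: lerXn2r; rewrite ?nnegrE ?sqr_ge0 //.
  by rewrite !mulr_ge0 // addr_ge0.
by rewrite mulrC.
Qed.
End Tails.

(** * From the probability space to finite Bernoulli sums *)

Section Law.
Local Open Scope classical_set_scope.
Local Open Scope ring_scope.
Context (R : realType) d (T : measurableType d) (P : probability T R).
Variables (E : finType) (X : E -> T -> bool) (pr : E -> R).

Definition bits w : {ffun E -> bool} := [ffun e => X e w].

Lemma probability_bits_eq (b : {ffun E -> bool}) :
  mutually_independent P X ->
  (forall e, measurable_fun [set: T] (X e)) ->
  (forall e, P [set w | X e w = true] = (pr e)%:E) ->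
  P [set w | bits w = b] = (\prod_e bern_weight (pr e) (b e))%:E.
Proof.
move=> ind mX law.
have := ind [set: E]%SET (fun e => [set b e]) (fun e => I).
rewrite (_ : [set w | _] = [set w | bits w = b]); last first.
  apply/seteqP; split => w /= h; first by apply/ffunP => e; rewrite ffunE; apply: h;
    rewrite inE.
  by move=> e _; rewrite -h ffunE.
move=> ->; rewrite (_ : (\prod_e bern_weight (pr e) (b e))%:E =
  \prod_e (bern_weight (pr e) (b e))%:E)%E; last first.
  by elim/big_rec2: _ => // e x y _ <-; rewrite EFinM.
apply: eq_big => [e|e _]; first by rewrite inE.
case: (b e) => /=; first by rewrite -law.
rewrite (_ : X e @^-1` [set false] = ~` [set w | X e w = true]).
  rewrite probability_setC; first by rewrite law.
  have := mX e measurableT [set true] I; rewrite setTI; exact.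
by apply/seteqP; split => w /=; case: (X e w) => //.
Qed.

Lemma measurable_bits (b : {ffun E -> bool}) :
  (forall e, measurable_fun [set: T] (X e)) -> measurable [set w | bits w = b].
Proof.
move=> mX.
rewrite (_ : [set w | _] = \bigcap_(e in [set: E]) (X e @^-1` [set b e])).
  apply: fin_bigcap_measurable => [|e _]; first exact: finite_finset.
  by have := mX e measurableT [set b e] I; rewrite setTI; exact.
apply/seteqP; split => w /=; first by move=> <- e _ /=; rewrite ffunE.
by move=> h; apply/ffunP => e; rewrite ffunE; exact: h.
Qed.

Lemma measurable_bits_pred (Q : {ffun E -> bool} -> Prop) :
  (forall e, measurable_fun [set: T] (X e)) -> measurable [set w | Q (bits w)].
Proof.
move=> mX.
rewrite (_ : [set w | Q (bits w)] = (\bigcup_(b in [set b | Q b]) [set w | bits w = b])).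
  by apply: fin_bigcup_measurable => [|b _]; [exact: finite_finset|exact: measurable_bits].
by apply/seteqP; split => w /= => [q|[b qb wb]]; [by exists (bits w)|by rewrite wb].
Qed.

(** The event is a finite union of fibers of [bits], whose probabilities are products by
    independence; subadditivity suffices because only failure probabilities are transferred. *)
Lemma probability_bits_le (Q : {ffun E -> bool} -> Prop) :
  mutually_independent P X ->
  (forall e, measurable_fun [set: T] (X e)) ->
  (forall e, P [set w | X e w = true] = (pr e)%:E) ->
  (P [set w | Q (bits w)] <= (bern_expect pr (fun b => `[< Q b >]%:R))%:E)%E.
Proof.
move=> ind mX law.
have H (s : seq {ffun E -> bool}) :
   (P (\big[setU/set0]_(b <- s | `[< Q b >]) [set w | bits w = b]) <=
   (\sum_(b <- s) (\prod_e bern_weight (pr e) (b e)) * `[< Q b >]%:R)%:E)%E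
   /\ measurable (\big[setU/set0]_(b <- s | `[< Q b >]) [set w | bits w = b]).
  elim: s => [|b s [IH mIH]]; first by rewrite !big_nil measure0.
  rewrite !big_cons; case: asboolP => Qb; last by rewrite mulr0 add0r.
  split; last by apply: measurableU => //; exact: measurable_bits.
  apply: (le_trans (measureU2 _ _ _)) => //; first exact: measurable_bits.
  by rewrite mulr1 EFinD -(probability_bits_eq b ind mX law); exact: leeD.
have [h mh] := H (index_enum _).
apply: le_trans h; apply: le_measure; rewrite ?inE //.
  exact: measurable_bits_pred.
move=> w /= q; rewrite -bigcup_seq_cond.
by exists (bits w) => //=; rewrite mem_index_enum; apply/asboolP.
Qed.
End Law.

(** * Logarithms and the exponent of the moment method *)

Section Numbers.
Context {R : realType}.

Lemma half_le_ln2 : 1 / 2 <= ln 2 :> R.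
Proof.
rewrite -ler_expR lnK ?posrE //.
have := expR_ge1Dx (- (1 / 2) : R); rewrite expRN => h.
have e0 := expR_gt0 (1 / 2 : R).
have : (1 - 1 / 2) * expR (1 / 2) <= (expR (1 / 2))^-1 * expR (1 / 2) :> R.
  by rewrite ler_pM2r.
by rewrite mulVf ?gt_eqF //; lra.
Qed.

Lemma half_le_ln_nat n : (2 <= n)%N -> 1 / 2 <= ln n%:R :> R.
Proof.
move=> n2; apply: (le_trans half_le_ln2); rewrite ler_ln ?posrE ?ltr0n //.
  by rewrite ler_nat.
exact: ltn_trans n2.
Qed.

(** Repeated squaring needs the exponent of the trace to be a power of 2, so the binary logarithm of
    n is rounded up to one. This less than doubles it, which keeps it of order ln n. *)
Lemma double_exp_bound n : (2 <= n)%N ->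
  exists j, (n <= 2 ^ (2 ^ j))%N /\ (2 ^ j)%:R <= 8 * ln n%:R :> R.
Proof.
move=> n2; have hL := half_le_ln_nat n2.
have /andP[lo hi] := up_log_bounds (isT : (1 < 2)%N) n2.
set u := up_log 2 n in lo hi.
exists (up_log 2 u); split.
  by apply: (leq_trans hi); rewrite leq_exp2l //; exact: up_logP.
have [u1|u1] := leqP u 1.
  have -> : up_log 2 u = 0%N by case: (u) u1 => [|[|]].
  by rewrite expn0; lra.
have /andP[lo' _] := up_log_bounds (isT : (1 < 2)%N) u1.
have : u.-1%:R * (1 / 2) <= ln n%:R :> R.
  apply: (@le_trans _ _ (u.-1%:R * ln 2)); first by rewrite ler_wpM2l // half_le_ln2.
  rewrite mulr_natl -lnXn // ler_ln ?posrE ?exprn_gt0 ?ltr0n //; last exact: ltn_trans n2.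
  by rewrite -natrX ler_nat ltnW.
have : (2 ^ up_log 2 u)%:R <= 4 * u.-1%:R :> R.
  rewrite -natrM ler_nat.
  have : up_log 2 u = (up_log 2 u).-1.+1 by rewrite prednK // up_log_gt0.
  move=> ->; rewrite expnS; lia.
lra.
Qed.
End Numbers.

Notation edge n := {e : 'I_n * 'I_n | (e.1 < e.2)%N}.

(** * Edges as unordered pairs of nodes *)

Section Edges.
Context {R : realType}.
Variable n : nat.

(** For i = j the second [insub] fails, so [None] encodes the zero diagonal. *)
Definition edge_of (i j : 'I_n) : option (edge n) :=
  if (i < j)%N then (insub (i, j) : option (edge n)) else insub (j, i).

Lemma edge_ofP i j e : edge_of i j = Some e -> val e = (i, j) \/ val e = (j, i).
Proof.
by rewrite /edge_of; case: ifP => _; case: insubP => // e' _ <- [<-]; [left|right].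
Qed.

Lemma edge_of_sym i j : edge_of i j = edge_of j i.
Proof. by rewrite /edge_of; case: ltngtP => // /val_inj ->. Qed.

Lemma edge_of_inj i j j' e : edge_of i j = Some e -> edge_of i j' = Some e -> j = j'.
Proof. by move=> /edge_ofP + /edge_ofP; case=> ->; case=> -[] //;
  [move=> -> ->|move=> ->]. Qed.

(** Turns a row sum over positions into a sum over edges, that is, over independent variables. *)
Lemma sum_option_inj (I J : finType) (A : pred I) (g : I -> option J) (F : J -> R) :
  (forall a a' e, g a = Some e -> g a' = Some e -> a = a') ->
  \sum_(a | A a) oapp F 0 (g a) =
  \sum_(e | [exists a, A a && (g a == Some e)]) F e.
Proof.
move=> gi.
transitivity (\sum_(a | A a) \sum_(e | g a == Some e) F e).
  apply: eq_bigr => a _; case: (g a) => [e|] /=; last by rewrite big_pred0.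
  by rewrite (big_pred1 e) // => e' /=; rewrite eq_sym.
rewrite (exchange_big_dep xpredT) //= [RHS]big_mkcond; apply: eq_bigr => e _.
case: existsP => [[a /andP[Aa /eqP ga]]|no]; last first.
  by rewrite big_pred0 // => a; apply/negP => h; apply: no; exists a.
rewrite (big_pred1 a) // => a' /=; apply/andP/eqP => [[_ /eqP ga']|->].
  exact: gi ga' ga.
by rewrite ga eqxx.
Qed.
End Edges.

(** * Decomposition of the inlier noise *)

Section EdgeNoise.
Context {R : realType}.
Variables (n r : nat) (kap : 'I_n -> 'I_r) (B : 'M[R]_r).

Definition edge_prob (e : edge n) : R := B (kap (val e).1) (kap (val e).2).

Definition edge_noise (b : {ffun edge n -> bool}) : 'M[R]_n :=
  noise_mx edge_prob xpredT (@edge_of n) b.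

Lemma edge_prob_ed i j e : B^T = B -> edge_of i j = Some e ->
  edge_prob e = B (kap i) (kap j).
Proof. by move=> sB /edge_ofP[] h; rewrite /edge_prob h //= -{1}sB mxE. Qed.

Definition row_mask i k : pred (edge n) :=
  fun e => [exists a, (kap a == k) && (edge_of i a == Some e)].

Lemma edge_noise_row b i k :
  (edge_noise b *m indmx kap) i k = \sum_e noise edge_prob (row_mask i k) e (b e).
Proof.
rewrite mulmx_ind; under eq_bigr => a _ do rewrite mxE.
rewrite (sum_option_inj _ _ (@edge_of_inj n i)) big_mkcond; apply: eq_bigr => e _.
by rewrite /noise -/(row_mask i k e); case: (row_mask i k e); rewrite ?mul0r ?mul1r.
Qed.

Lemma sum_row_mask_le i k (s : R) : 0 <= s ->
  \sum_(e | row_mask i k e) s <= s * block_size kap k.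
Proof.
move=> s0; rewrite -(sum_option_inj _ (fun=> s) (@edge_of_inj n i)) -sum_blk.
by apply: ler_sum => a _; case: (edge_of i a).
Qed.

Definition blk_mask k : pred (edge n) :=
  fun e => (kap (val e).1 == k) && (kap (val e).2 == k).

Definition off_mask : pred (edge n) := fun e => kap (val e).1 != kap (val e).2.

(** The parts are bounded separately because their variances have different scales: B k k times the
    block size inside a community, at most [q * n] per row between communities. The former is
    compared with the gap of that community, the latter with delta times the minimal size. *)
Lemma edge_noise_split b :
  edge_noise b = noise_mx edge_prob off_mask (@edge_of n) b
    + \sum_k noise_mx edge_prob (blk_mask k) (@edge_of n) b.
Proof.
apply/matrixP => i j; rewrite [RHS]mxE summxE; under eq_bigr => k _ do rewrite mxE.
rewrite !mxE; case: (edge_of i j) => [e|] /=; last by rewrite big1 ?addr0.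
rewrite /noise -mulr_suml -mulrDl; congr (_ * _).
rewrite /off_mask; have [e12|e12] := eqVneq (kap (val e).1) (kap (val e).2).
  rewrite add0r (bigD1 (kap (val e).1)) //= /blk_mask -e12 eqxx big1 ?addr0 // => k.
  by rewrite eq_sym => /negbTE ->.
rewrite big1 ?addr0 // => k _; rewrite /blk_mask.
by case: eqP => // <-; rewrite eq_sym (negbTE e12).
Qed.

Lemma quad_sum (I : finType) (F : I -> 'M[R]_n) v :
  quad (\sum_k F k) v = \sum_k quad (F k) v.
Proof.
elim/big_rec2: _ => [|k x y _ <-]; last by rewrite quadD.
by rewrite /quad mulmx0 mul0mx mxE.
Qed.

Definition restr k (u : 'cV[R]_n) : 'cV[R]_n := \col_i ((kap i == k)%:R * u i 0).

Lemma quad_blk_noise b k u :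
  quad (noise_mx edge_prob (blk_mask k) (@edge_of n) b) u =
  quad (noise_mx edge_prob (blk_mask k) (@edge_of n) b) (restr k u).
Proof.
rewrite !quadE; apply: eq_bigr => i _; apply: eq_bigr => j _; rewrite !mxE.
case eij : (edge_of i j) => [e|] /=; last by rewrite !mulr0 !mul0r.
rewrite /noise /blk_mask; have [] := edge_ofP eij => -> /=;
by case: eqP => _ /=; case: eqP => _ /=; rewrite ?mul0r ?mulr0 ?mul0r ?mul1r.
Qed.

Lemma sqn_restr k u : sqn (restr k u) = \sum_(i | kap i == k) u i 0 ^+ 2.
Proof.
rewrite [RHS]big_mkcond; apply: eq_bigr => i _; rewrite mxE.
by case: eqP => _; rewrite ?mul1r // mul0r expr0n.
Qed.

Lemma edge_noise_quad_le b (t : 'I_r -> R) t0 :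
  (forall k u, quad (noise_mx edge_prob (blk_mask k) (@edge_of n) b) u <= t k * sqn u) ->
  (forall u, quad (noise_mx edge_prob off_mask (@edge_of n) b) u <= t0 * sqn u) ->
  forall u, quad (edge_noise b) u <= \sum_i (t (kap i) + t0) * u i 0 ^+ 2.
Proof.
move=> hk h0 u; rewrite edge_noise_split quadD quad_sum.
rewrite [leRHS](_ : _ = t0 * sqn u + \sum_i t (kap i) * u i 0 ^+ 2); last first.
  by rewrite mulr_sumr -big_split; apply: eq_bigr => i _; rewrite mulrDl addrC.
apply: lerD => //.
rewrite (partition_big kap xpredT) //=; apply: ler_sum => k _.
rewrite quad_blk_noise; apply: (le_trans (hk _ _)); rewrite sqn_restr mulr_sumr.
by apply: ler_sum => i /eqP ->.
Qed.

Lemma variance_blk_le k i : B^T = B -> 0 <= B k k ->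
  \sum_j oapp (fun e => (blk_mask k e)%:R * B k k) 0 (edge_of i j) <=
    B k k * block_size kap k.
Proof.
move=> sB B0; rewrite -sum_blk [leRHS]big_mkcond; apply: ler_sum => j _.
case eij : (edge_of i j) => [e|] /=; last by case: ifP.
rewrite /blk_mask; have [] := edge_ofP eij => -> /=;
by case: (kap i == k); case: (kap j == k); rewrite /= ?mul0r ?mul1r.
Qed.

Lemma variance_off_le (q : R) i : 0 <= q ->
  \sum_j oapp (fun e => (off_mask e)%:R * q) 0 (edge_of i j) <= q * n%:R.
Proof.
move=> q0; rewrite mulr_natr -[X in _ *+ X]card_ord -sumr_const; apply: ler_sum => j _.
by case: (edge_of i j) => [e|] //=; case: (off_mask e); rewrite ?mul0r ?mul1r.
Qed.

End EdgeNoise.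

(** * Tail bounds for row sums and quadratic forms *)

Section NoiseTails.
Context {R : realType}.

Lemma row_tail n r (kap : 'I_n -> 'I_r) (B : 'M[R]_r) i k (g s : R) :
  (forall e, 0 <= edge_prob kap B e <= 1) ->
  (forall e, row_mask kap i k e -> edge_prob kap B e <= s) ->
  (0 < n)%N -> 0 < g -> g <= s -> 0 < s ->
  32 * 64 * (6 * (s * ln n%:R)) <= g ^+ 2 * block_size kap k ->
  bern_expect (edge_prob kap B) (fun b =>
    (g / 16 * block_size kap k < `|(edge_noise kap B b *m indmx kap) i k|)%R%:R) <=
  2 / n%:R ^+ 6.
Proof.
move=> pr01 cs n0 g0 gs s0 hs; under eq_bern_expect => b do rewrite edge_noise_row.
(* This theta minimizes the Chernoff exponent 2 theta^2 s l - theta g l / 16, where l is the block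
   size; the minimum is - g^2 l / (2048 s), and 2048 is the factor 32 * 64 of the hypothesis. *)
have th : 0 <= g / (64 * s) <= 1 / 2.
  rewrite divr_ge0 ?mulr_ge0 ?(ltW g0) ?(ltW s0) //= ler_pdivrMr ?mulr_gt0 //.
  by move: gs s0; clear; lra.
apply: (le_trans (@bern_expect_noise_tail _ _ _ _ (fun=> s) (g / (64 * s)) (g / 16 *
  block_size kap k) (s * block_size kap k) pr01 cs th _)).
  by apply: sum_row_mask_le; exact: ltW.
rewrite ler_pM2l //.
have n0R : 0 < n%:R :> R by rewrite ltr0n.
have -> : (n%:R ^+ 6)^-1 = expR (- (6 * ln n%:R)) :> R.
  by rewrite expRN expRM_natl lnK // posrE.
rewrite ler_expR lerNr.
have -> : - (2 * (g / (64 * s)) ^+ 2 * (s * block_size kap k) - g / (64 * s) * (g / 16 *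
  block_size kap k))
  = g ^+ 2 * block_size kap k / (32 * 64 * s) by field; exact: lt0r_neq0.
have s1 : 0 < 32 * 64 * s by rewrite !mulr_gt0.
by rewrite (ler_pdivlMr _ _ s1); move: hs; clear; lra.
Qed.

Lemma quad_tail n r (kap : 'I_n -> 'I_r) (B : 'M[R]_r) (c : pred (edge n)) (s a t : R) j :
  (forall e, 0 <= edge_prob kap B e <= 1) ->
  (forall e, c e -> edge_prob kap B e <= s) -> 0 <= s -> 0 <= a ->
  (forall i, \sum_j oapp (fun e => (c e)%:R * s) 0 (edge_of i j) <= a) ->
  (2 <= n)%N -> (n <= 2 ^ (2 ^ j))%N -> (2 ^ j)%:R <= 8 * ln n%:R :> R ->
  0 < t -> 32 * 64 * (32 * 64 * (a * ln n%:R)) <= (16 * t) ^+ 2 ->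
    32 * 64 * (4 * ln n%:R) <= 16 * t ->
  bern_expect (edge_prob kap B) (fun b => `[< exists u, t * sqn u <
     quad (noise_mx (edge_prob kap B) c (@edge_of n) b) u >]%:R) <= (n%:R ^+ 5)^-1.
Proof.
move=> pr01 cs s0 a0 va n2 nj jL t0 h1 h2.
have L0 := @half_le_ln_nat R _ n2.
have n0R : 0 < n%:R :> R by rewrite ltr0n; exact: ltn_trans n2.
apply: (le_trans (@bern_expect_quad_tail _ _ _ _ _ _ (fun e => (c e)%:R * s) a t j pr01
  (@edge_of_inj n) (@edge_of_sym n) _ _ va a0 t0 _)).
- by move=> e ce; rewrite ce mul1r cs.
- by move=> e; rewrite mulr_ge0.
(* The two terms of k (a + k) are absorbed separately: k a by [h1] and k^2 by the square of [h2],
   using k <= 8 L. *)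
- set k := (2 ^ j)%:R in jL *; set L := ln n%:R in L0 jL h1 h2.
  have k0 : 0 <= k by rewrite ler0n.
  have q1 : k * a <= 8 * L * a by apply: ler_wpM2r.
  have q2 : k * k <= (8 * L) * (8 * L) by apply: ler_pM.
  have q3 : (32 * 64 * (4 * L)) * (32 * 64 * (4 * L)) <= (16 * t) * (16 * t).
    by apply: ler_pM => //; move: L0; clear; lra.
  have t2 : 0 <= t * t by rewrite mulr_ge0 // ltW.
  by move: t2 q1 q2 q3 h1 a0; clear; rewrite !expr2; lra.
(* As 64 = 2^6 and n <= 2^(2^j), the denominator is at least n^6, which leaves n / n^6. *)
- rewrite ler_pdivrMr ?exprn_gt0 // mulrC ler_pdivlMr ?exprn_gt0 //.
  rewrite -exprS -natrX -natrX ler_nat (_ : 64%N = (2 ^ 6)%N) // -expnM mulnC expnM.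
  by rewrite leq_exp2r.
Qed.

Lemma edge_noise_concentration n r (kap : 'I_n -> 'I_r) (B : 'M[R]_r)
    (lambda delta nm p q : R) :
  (2 <= n)%N -> (r <= n)%N -> B^T = B -> (forall i j, 0 <= B i j <= 1) ->
  0 < delta -> delta <= p -> 0 <= q -> q <= p ->
  (forall k, (0 : R) < block_size kap k) -> 0 < nm -> 0 <= lambda ->
  (forall k, 0 < B k k - lambda) ->
  (forall k k', k != k' -> B k k' <= q) ->
  (forall k, 32 * 64 * (32 * 64 * (B k k * ln n%:R)) <=
    (B k k - lambda) ^+ 2 * block_size kap k) ->
  (forall k, 32 * 64 * (32 * 64 * (p * ln n%:R)) <= delta ^+ 2 * block_size kap k) ->
  (forall k, 32 * 64 * (4 * ln n%:R) <= (B k k - lambda) * block_size kap k) ->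
  32 * 64 * (32 * 64 * (q * n%:R * ln n%:R)) <= (delta * nm) ^+ 2 ->
  32 * 64 * (4 * ln n%:R) <= delta * nm ->
  bern_expect (edge_prob kap B) (fun b => `[< ~
    ((forall i k, `|(edge_noise kap B b *m indmx kap) i k| <=
       (if kap i == k then B k k - lambda else delta) / 16 * block_size kap k) /\
     (forall u, quad (edge_noise kap B b) u <=
       \sum_i ((B (kap i) (kap i) - lambda) / 16 * block_size kap (kap i)
         + delta * nm / 16) * u i 0 ^+ 2)) >]%:R) <= n%:R^-1.
Proof.
move=> n2 rn sB B01 d0 dp q0 qp l0 nm0 lam0 g0 Bq F1 F2 F3 F4 F5.
have L0 := @half_le_ln_nat R _ n2.
have pr01 e : 0 <= edge_prob kap B e <= 1 by exact: B01.
have [j [nj jL]] := @double_exp_bound R _ n2.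
have n0 : (0 < n)%N by exact: ltn_trans n2.
pose g i k := if kap i == k then B k k - lambda else delta.
pose t k := (B k k - lambda) / 16 * block_size kap k.
pose t0 := delta * nm / 16.
pose c1 (b : {ffun edge n ->
  bool}) i k : R := (g i k / 16 * block_size kap k < `|(edge_noise kap B b *m indmx kap)
    i k|)%R%:R.
pose c2 (b : {ffun edge n -> bool}) k : R := `[< exists u, t k * sqn u <
     quad (noise_mx (edge_prob kap B) (blk_mask kap k) (@edge_of n) b) u >]%:R.
pose c3 (b : {ffun edge n -> bool}) : R := `[< exists u, t0 * sqn u <
     quad (noise_mx (edge_prob kap B) (off_mask kap) (@edge_of n) b) u >]%:R.
(* Union bound through indicators: if their sum is below 1, each is 0 and no bound fails. *)
apply: (@le_trans _ _ (bern_expect (edge_prob kap B) (fun b =>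
   \sum_i \sum_k c1 b i k + (\sum_k c2 b k + c3 b)))).
  apply: ler_bern_expect => // b.
  have c10 i k : 0 <= c1 b i k by [].
  have c20 k : 0 <= c2 b k by [].
  have c30 : 0 <= c3 b by [].
  have s10 : 0 <= \sum_i \sum_k c1 b i k by apply: sumr_ge0 => ? _; apply: sumr_ge0.
  have s20 : 0 <= \sum_k c2 b k by apply: sumr_ge0.
  case: asboolP => [bad|_] /=; last by rewrite !addr_ge0.
  rewrite leNgt; apply/negP => lt1; apply: bad.
  have z1 i k : c1 b i k < 1.
    apply: le_lt_trans lt1; rewrite -[leLHS]addr0; apply: lerD; last exact: addr_ge0.
    rewrite (bigD1 i) //= (bigD1 k) //= -addrA lerDl addr_ge0 // sumr_ge0 // => ? _.
    exact: sumr_ge0.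
  have z2 k : c2 b k < 1.
    apply: le_lt_trans lt1; rewrite (bigD1 k) //= [X in _ <= X]addrC -!addrA lerDl.
    by rewrite !addr_ge0 // sumr_ge0.
  have z3 : c3 b < 1.
    by apply: le_lt_trans lt1; rewrite addrA lerDr addr_ge0.
  split.
    move=> i k; rewrite leNgt; apply/negP => h; have := z1 i k.
    by rewrite /c1 /g h ltxx.
  apply: (@edge_noise_quad_le _ _ _ _ _ _ t t0).
    move=> k u; rewrite leNgt; apply/negP => h; have := z2 k.
    by rewrite /c2; case: asboolP => [_|[]]; [rewrite ltxx|exists u].
  move=> u; rewrite leNgt; apply/negP => h; have := z3.
  by rewrite /c3; case: asboolP => [_|[]]; [rewrite ltxx|exists u].
rewrite !bern_expectD !bern_expect_sum; under eq_bigr => i _ do rewrite bern_expect_sum.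
have n0R : 0 < n%:R :> R by rewrite ltr0n.
have h1 : \sum_i \sum_k bern_expect (edge_prob kap B) (fun b => c1 b i k) <=
   \sum_(i < n) \sum_(k < r) 2 / n%:R ^+ 6.
  apply: ler_sum => i _; apply: ler_sum => k _; rewrite /c1 /g.
  have [ik|ik] := eqVneq (kap i) k.
    apply: (@row_tail _ _ _ _ _ _ _ (B k k)) => //.
    - move=> e /existsP[a /andP[/eqP ak /eqP ia]].
      by rewrite (edge_prob_ed kap sB ia) ik ak.
    - by move: lam0; clear; lra.
    - by move: lam0 (g0 k); clear; lra.
    - have := F1 k; have := B01 k k => /andP[b0 _].
      have : 0 <= B k k * ln n%:R by rewrite mulr_ge0 //; move: L0; clear; lra.
      by clear; lra.
  apply: (@row_tail _ _ _ _ _ _ _ p) => //.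
  - move=> e /existsP[a /andP[/eqP ak /eqP ia]].
    by rewrite (edge_prob_ed kap sB ia) ak (le_trans (Bq _ _ ik)).
  - exact: lt_le_trans d0 dp.
  - have := F2 k.
    have : 0 <= p * ln n%:R.
      by rewrite mulr_ge0 //; move: L0 d0 dp; clear; lra.
    by clear; lra.
have h2 : \sum_k bern_expect (edge_prob kap B) (fun b => c2 b k) <=
  \sum_(k < r) (n%:R ^+ 5)^-1.
  apply: ler_sum => k _; have /andP[b0 _] := B01 k k.
  apply: (@quad_tail _ _ _ _ _ (B k k) (B k k * block_size kap k) _ j) => //.
  - by move=> e /andP[/eqP e1 /eqP e2]; rewrite /edge_prob e1 e2.
  - by rewrite mulr_ge0 // ltW.
  - by move=> i; exact: variance_blk_le.
  - by rewrite /t !mulr_gt0 // invr_gt0.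
  - have -> : (16 * t k) ^+ 2 = (B k k - lambda) ^+ 2 * block_size kap k * block_size kap k.
      by rewrite /t; field.
    have -> : 32 * 64 * (32 * 64 * (B k k * block_size kap k * ln n%:R)) =
       32 * 64 * (32 * 64 * (B k k * ln n%:R)) * block_size kap k by ring.
    by rewrite ler_pM2r.
  - by have := F3 k; rewrite /t; clear; lra.
have h3 : bern_expect (edge_prob kap B) c3 <= (n%:R ^+ 5)^-1.
  apply: (@quad_tail _ _ _ _ _ q (q * n%:R) _ j) => //.
  - by move=> e; exact: Bq.
  - by rewrite mulr_ge0.
  - by move=> i; exact: variance_off_le.
  - by rewrite /t0 !mulr_gt0 // invr_gt0.
  - by have -> : 16 * t0 = delta * nm by rewrite /t0; field.
  - by have -> : 16 * t0 = delta * nm by rewrite /t0; field.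
apply: (le_trans (lerD h1 (lerD h2 h3))).
have sumE u (x : R) : \sum_(k < u) x = x * u%:R by rewrite sumr_const card_ord mulr_natr.
under eq_bigr => i _ do rewrite sumE.
rewrite !sumE -(ler_pM2r (exprn_gt0 6 n0R)).
rewrite [leLHS](_ : _ = 2 * r%:R * n%:R + (r%:R * n%:R + n%:R)); last first.
  by field; exact: lt0r_neq0.
have -> : n%:R^-1 * n%:R ^+ 6 = n%:R ^+ 5 :> R by field; exact: lt0r_neq0.
(* After multiplication by n^6 the claim is 3 r n + n <= n^5, which follows from r <= n and 4 <=
   n^3. *)
rewrite -!natrM -!natrX -!natrD ler_nat.
apply: (@leq_trans (4 * n * n)).
  have : (r * n <= n * n)%N by rewrite leq_mul2r rn orbT.
  have : (n <= n * n)%N by rewrite leq_pmulr.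
  by rewrite -!mulnA; move: (r * n)%N (n * n)%N => u v; clear; lia.
have h8 : (2 ^ 3 <= n ^ 3)%N by rewrite leq_exp2r.
rewrite (expnD n 3 2) -mulnA mulnn leq_mul2r; apply/orP; right.
exact: leq_trans h8.
Qed.
End NoiseTails.

(** * Assembling the bounds *)

Section SeparationBounds.
Context {R : realType}.

(** Every summand of the hypothesis is nonnegative, so each one alone, multiplied by C, is at most
    delta. *)
Lemma separation_bounds (C n m r nm p q delta alpha L : R) :
  1 <= C -> 0 < nm -> 0 <= n -> 0 <= m -> 0 <= r -> 0 <= p -> 0 <= q -> 0 <= L ->
  0 < delta -> 3 * m <= alpha ->
  C * (L / nm) <= p ->
  C * (Num.sqrt (p * L / nm) + alpha / nm + Num.sqrt (n * q * L) / nm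
       + m * Num.sqrt r / nm + n * m * p / ((alpha - 2 * m) * nm)) < delta ->
  [/\ C ^+ 2 * (p * L) <= delta ^+ 2 * nm, C * alpha <= delta * nm,
      C ^+ 2 * (n * q * L) <= (delta * nm) ^+ 2,
      C * (m * Num.sqrt r) <= delta * nm /\
      C * (n * m * p / (alpha - 2 * m)) <= delta * nm &
      C * L <= p * nm /\ C * L <= delta * nm].
Proof.
move=> C1 nm0 n0 m0 r0 p0 q0 L0 d0 am hp.
have C0 : 0 < C by exact: lt_le_trans C1.
have al0 : 0 <= alpha by move: am m0; clear; lra.
have a2 : 0 <= alpha - 2 * m by move: am m0; clear; lra.
set x1 := Num.sqrt (p * L / nm); set x2 := alpha / nm.
set x3 := _ / nm; set x4 := _ / nm; set x5 := _ / (_ * nm).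
have y1 : 0 <= C * x1 by rewrite mulr_ge0 ?sqrtr_ge0 // ltW.
have y2 : 0 <= C * x2 by rewrite mulr_ge0 ?divr_ge0 // ltW.
have y3 : 0 <= C * x3 by rewrite mulr_ge0 ?divr_ge0 ?sqrtr_ge0 // ltW.
have y4 : 0 <= C * x4 by rewrite mulr_ge0 ?divr_ge0 ?mulr_ge0 ?sqrtr_ge0 // ltW.
have y5 : 0 <= C * x5 by rewrite mulr_ge0 ?divr_ge0 ?mulr_ge0 // ltW.
rewrite !(mulrDr C) => hs.
have z1 : C * x1 <= delta by move: hs y1 y2 y3 y4 y5; clear; lra.
have z2 : C * x2 <= delta by move: hs y1 y2 y3 y4 y5; clear; lra.
have z3 : C * x3 <= delta by move: hs y1 y2 y3 y4 y5; clear; lra.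
have z4 : C * x4 <= delta by move: hs y1 y2 y3 y4 y5; clear; lra.
have z5 : C * x5 <= delta by move: hs y1 y2 y3 y4 y5; clear; lra.
have sqle (x y : R) : 0 <= x -> x <= y -> x ^+ 2 <= y ^+ 2.
  by move=> x0 xy; apply: lerXn2r; rewrite ?nnegrE // (le_trans x0).
have w1 : C ^+ 2 * (p * L) <= delta ^+ 2 * nm.
  have xx : 0 <= p * L / nm by rewrite divr_ge0 ?mulr_ge0 // ltW.
  have := sqle _ _ y1 z1; rewrite exprMn /x1 (sqr_sqrtr xx).
  by rewrite [X in X <= _]mulrA ler_pdivrMr.
have hL : C * L <= p * nm by move: hp; rewrite mulrA ler_pdivrMr.
split => //.
- by rewrite -ler_pdivrMr // -mulrA.
- have {}z3 : C * Num.sqrt (n * q * L) <= delta * nm.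
    by rewrite -ler_pdivrMr // -(mulrA C).
  have := sqle _ _ _ z3; rewrite exprMn sqr_sqrtr; last by rewrite !mulr_ge0.
  by apply; rewrite mulr_ge0 ?sqrtr_ge0 // ltW.
- split; first by rewrite -ler_pdivrMr // -mulrA.
  by move: z5; rewrite /x5 invfM -ler_pdivrMr // -!mulrA.
- split => //.
  have CL0 : 0 <= C * L by rewrite mulr_ge0 // ltW.
  have dn0 : 0 <= delta * nm by rewrite mulr_ge0 // ltW.
  (* C L <= delta nm comes from combining the lower bound on p with the square-root term: (C L)^2 <=
     C L p nm <= C^2 p L nm <= (delta nm)^2. *)
  rewrite -(@ler_pXn2r _ 2) ?nnegrE //.
  have e1 : C * L * (C * L) <= C * L * (p * nm) by apply: ler_wpM2l.
  have e2 : C ^+ 2 * (p * L) * nm <= delta ^+ 2 * nm * nm by rewrite ler_pM2r.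
  have e3 : 0 <= (C - 1) * (C * L * p * nm).
    by rewrite !mulr_ge0 ?subr_ge0 // ltW.
  by move: e1 e2 e3; clear; rewrite !expr2; lra.
Qed.

(** A community may be much denser than the sparsest one. For b <= 2 p the gap delta / 4 suffices,
    the noise being comparable to that of density p; for b > 2 p the gap exceeds b / 2 and the bound
    C L <= p nm takes over. *)
Lemma gap_bounds (C nm p delta lambda b l L : R) :
  64 * 64 * (64 * 64) <= C -> 0 < nm -> nm <= l -> 0 <= p -> 0 <= L -> 0 < delta ->
  p <= b -> lambda < p - delta / 4 ->
  C ^+ 2 * (p * L) <= delta ^+ 2 * nm -> C * L <= p * nm ->
  32 * 64 * (32 * 64 * (b * L)) <= (b - lambda) ^+ 2 * l.
Proof.
move=> hC nm0 nl p0 L0 d0 pb lam h1 h2.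
have C1 : 1 <= C by move: hC; clear; lra.
have bL : 0 <= b * L by rewrite mulr_ge0 // (le_trans p0).
have pL : 0 <= p * L by rewrite mulr_ge0.
have g0 : 0 <= b - lambda by move: pb lam d0; clear; lra.
apply: (@le_trans _ _ ((b - lambda) ^+ 2 * nm)); last first.
  by apply: ler_wpM2l => //; exact: sqr_ge0.
have [b2|b2] := leP b (2 * p).
  have e1 : (delta / 4) ^+ 2 * nm <= (b - lambda) ^+ 2 * nm.
    apply: ler_wpM2r; first exact: ltW.
    by apply: lerXn2r; rewrite ?nnegrE //; move: pb lam d0; clear; lra.
  have e2 : (64 * 64 * (64 * 64)) * 64 * (p * L) <= C * C * (p * L).
    by apply: ler_wpM2r => //; apply: ler_pM => //; move: hC; clear; lra.
  have e3 : b * L <= 2 * p * L by apply: ler_wpM2r.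
  by move: e1 e2 e3 h1 pL; clear; rewrite !expr2; lra.
have e1 : (b / 2) * (b / 2) * nm <= (b - lambda) ^+ 2 * nm.
  rewrite expr2; apply: ler_wpM2r; first exact: ltW.
  by apply: ler_pM; move: b2 p0 lam d0; clear; lra.
have b0 : 0 <= b by exact: le_trans pb.
have e2 : b * p * nm <= b * b * nm.
  by apply: ler_wpM2r; [exact: ltW|exact: ler_wpM2l].
have e3 : b * (C * L) <= b * (p * nm) by apply: ler_wpM2l.
have e4 : (64 * 64 * (64 * 64)) * (b * L) <= C * (b * L) by apply: ler_wpM2r.
by move: e1 e2 e3 e4 bL; clear; lra.
Qed.
End SeparationBounds.

Local Open Scope classical_set_scope.
Local Open Scope ring_scope.

(** * Invariance of the semidefinite program under permutations of the nodes *)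

Section Relabeling.
Context {R : realType}.

Definition relabel N (g : 'S_N) (M : 'M[R]_N) : 'M[R]_N :=
  perm_mx g *m M *m (perm_mx g)^T.

Lemma relabelE N (g : 'S_N) (M : 'M[R]_N) i j : relabel g M i j = M (g i) (g j).
Proof. by rewrite /relabel tr_perm_mx -row_permE -col_permE !mxE. Qed.

Lemma relabelVK N (g : 'S_N) : cancel (@relabel N g^-1) (relabel g).
Proof. by move=> M; apply/matrixP => i j; rewrite !relabelE !permK. Qed.

Lemma sdp_cost_relabel N (g : 'S_N) alpha lambda (A : 'M[R]_N) :
  sdp_cost alpha lambda (relabel g A) = relabel g (sdp_cost alpha lambda A).
Proof.
by apply/matrixP => i j; rewrite relabelE !sdp_costE relabelE (inj_eq perm_inj).
Qed.

Lemma sdp_feasible_relabel N (g : 'S_N) (X : 'M[R]_N) :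
  sdp_feasible X -> sdp_feasible (relabel g X).
Proof.
move=> [[sX pX] X01]; split; last by move=> i j; rewrite relabelE.
split=> [|v]; last by rewrite -/(quad _ v) /relabel quad_conj; exact: pX.
by apply/matrixP => i j; rewrite mxE !relabelE -{1}sX mxE.
Qed.

Lemma mxtrace_relabel N (g : 'S_N) (X E : 'M[R]_N) :
  \tr ((relabel g X)^T *m relabel g E) = \tr (X^T *m E).
Proof.
rewrite /mxtrace [RHS](reindex_inj (@perm_inj _ g)) /=; apply: eq_bigr => i _.
rewrite [LHS]mxE [RHS]mxE [RHS](reindex_inj (@perm_inj _ g)) /=.
by apply: eq_bigr => j _; rewrite [in LHS]mxE [in RHS]mxE !relabelE.
Qed.

Lemma sdp_solution_relabel N (g : 'S_N) (E X : 'M[R]_N) :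
  sdp_solution (relabel g E) X -> sdp_solution E (relabel g^-1 X).
Proof.
move=> [fX oX]; split => [|X' fX']; first exact: sdp_feasible_relabel.
rewrite -[X in X <= _](mxtrace_relabel g) -[X in _ <= X](mxtrace_relabel g) relabelVK.
exact/oX/sdp_feasible_relabel.
Qed.
End Relabeling.

Lemma card_sig1 r (l : 'I_r -> nat) k :
  #|[set i : 'I_(\sum_(i < r) l i) | tagnat.sig1 i == k]%SET| = l k.
Proof.
have Rinj : injective (@tagnat.Rank _ l k).
  move=> j j' /(congr1 val)/eqP; rewrite tagnat.eq_Rank eqxx => /eqP.
  exact: val_inj.
rewrite -[RHS]card_ord -(card_imset _ Rinj); apply: eq_card => i; rewrite inE.
apply/eqP/imsetP => [ki|[j _ ->]]; last exact: tagnat.Rank1K.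
by case: _ / ki; exists (tagnat.sig2 i); rewrite ?inE ?tagnat.sig2K.
Qed.

Lemma nmin_le r (l : 'I_r -> nat) k : (nmin l <= l k)%N.
Proof.
have le_l (s : seq 'I_r) x : k \in s -> (\big[minn/x]_(i <- s) l i <= l k)%N.
  elim: s => // a s IH; rewrite inE big_cons geq_min => /predU1P[->|/IH ->].
    by rewrite leqnn.
  by rewrite orbT.
by apply: le_l; rewrite mem_index_enum.
Qed.

Lemma nmin_gt0 r (l : 'I_r -> nat) : (0 < \sum_(i < r) l i)%N ->
  (forall k, 0 < l k)%N -> (0 < nmin l)%N.
Proof.
by move=> n0 l0; rewrite /nmin; elim/big_ind: _ => // x y x0 y0; rewrite leq_min x0.
Qed.

Lemma muln_nmin_le r (l : 'I_r -> nat) : (r * nmin l <= \sum_(i < r) l i)%N.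
Proof.
rewrite -[X in (X * _)%N]card_ord -sum_nat_const; apply: leq_sum => i _.
exact: nmin_le.
Qed.

(** * Translation between the model and the deterministic lemmas *)

Section Communities.
Context {R : realType}.

Lemma qplus_ge r (B : 'M[R]_r) k k' : B^T = B -> k != k' -> B k k' <= qplus B.
Proof.
move=> sB; have le_q (p : 'I_r * 'I_r) : (p.1 < p.2)%N -> B p.1 p.2 <= qplus B.
  by move=> h; apply: (le_bigmax_cond 0 (fun p : 'I_r * 'I_r => B p.1 p.2)).
case: (ltngtP k k') => [h|h|/val_inj ->]; rewrite ?eqxx // => _.
  exact: (le_q (k, k')).
by rewrite -{1}sB mxE; exact: (le_q (k', k)).
Qed.

Lemma edge_noise_bits n r (kap : 'I_n -> 'I_r) (B : 'M[R]_r) (K : 'M[bool]_n) :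
  B^T = B -> K^T = K -> (forall i, K i i = false) ->
  edge_noise kap B [ffun e : edge n => K (val e).1 (val e).2] =
  map_mx (fun b : bool => b%:R) K -
    \matrix_(i, a) (if i == a then 0 else B (kap i) (kap a)).
Proof.
move=> sB sK dK; apply/matrixP => i a; rewrite !mxE.
case eia : (edge_of i a) => [e|] /=.
  rewrite /noise mul1r ffunE (edge_prob_ed kap sB eia).
  have se : sval e = (i, a) \/ sval e = (a, i) := edge_ofP eia.
  have le : ((sval e).1 < (sval e).2)%N := valP e.
  case: se le => -> /=.
    by case: eqP => [->|_]; rewrite ?ltnn.
  by case: eqP => [->|_]; rewrite ?ltnn // -{1}sK mxE.
have -> : i = a.
  apply/val_inj/eqP; move: eia; rewrite /edge_of.
  by case: ltngtP => // h; rewrite insubT.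
by rewrite eqxx dK subr0.
Qed.

Lemma gsbm_label_lt r m (l : 'I_r -> nat) (s : 'S_((\sum_(i < r) l i) + m)) u :
  (gsbm_label s u < r)%N ->
  exists2 i, s u = lshift m i & gsbm_label s u = tagnat.sig1 i.
Proof.
rewrite /gsbm_label; case: (split_ordP (s u)) => [i ->|j _]; last by rewrite ltnn.
by exists i; rewrite ?(unsplitK (inl _)).
Qed.

Lemma misclassification_rate_blocks r m (l : 'I_r -> nat)
    (s : 'S_((\sum_(i < r) l i) + m)) (X : 'M[R]_((\sum_(i < r) l i) + m))
    (y : 'I_((\sum_(i < r) l i) + m) -> 'cV[R]_((\sum_(i < r) l i) + m))
    (f : 'I_((\sum_(i < r) l i) + m) -> 'I_r) :
  (2 <= r)%N -> sdp_feasible X ->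
  (forall i a, relabel s^-1 X (lshift m i) (lshift m a) =
     (tagnat.sig1 i == tagnat.sig1 a)%:R) ->
  m%:R < (nmin l)%:R / (2 * r%:R + 4) :> R ->
  normalized_columns X y -> kmeans_solution y f ->
  misclassification_rate R (\sum_(i < r) l i) (gsbm_label s) f
    <= (2 * r%:R + 3) * m%:R / (\sum_(i < r) l i)%:R.
Proof.
move=> r2 fX hX mnm ny ks; apply: misclassification_rate_le.
  by rewrite mulr_ge0 // addr_ge0 // mulr_ge0.
move=> p hp; apply: (kmeans_pairs fX _ _ _ r2 mnm ny ks hp).
- move=> u v /gsbm_label_lt[i ui ->] /gsbm_label_lt[a va ->].
  by rewrite (inj_eq (@ord_inj _)) -hX relabelE -ui -va !permK.
- rewrite ler_nat -[leqRHS]card_ord -cardsT.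
  apply: (@leq_trans #|[set (s^-1)%g (rshift (\sum_(i < r) l i) j) | j in [set:
    'I_m]%SET]%SET|); last first.
    exact: leq_imset_card.
  apply: subset_leq_card; apply/fintype.subsetP => u; rewrite inE /gsbm_label.
  case: (split_ordP (s u)) => [i _|j uj _]; first by rewrite leqNgt ltn_ord.
  by apply/imsetP; exists j; rewrite ?inE // -uj permK.
- move=> u /gsbm_label_lt[i ui ui']; rewrite ler_nat.
  apply: (leq_trans (nmin_le l (tagnat.sig1 i))); rewrite -card_sig1.
  have inj : injective (fun a => (s^-1)%g (lshift m a)).
    by move=> a b /perm_inj/lshift_inj.
  rewrite -(card_imset _ inj); apply: subset_leq_card; apply/fintype.subsetP => v.
  case/imsetP => a; rewrite !inE => /eqP ai ->.
  by rewrite ui' /gsbm_label permKV (unsplitK (inl a)) ai.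
Qed.

End Communities.

Theorem theorem3p2 (R : realType) :
  exists C c : R, 0 < C /\ 0 < c /\
  forall (d : measure_display) (T : measurableType d) (P : probability T R)
    (r m : nat) (l : 'I_r -> nat) (B : 'M[R]_r)
    (K : T -> 'M[bool]_(\sum_(i < r) l i))
    (Z : T -> 'M[bool]_(\sum_(i < r) l i, m))
    (W : T -> 'M[bool]_m)
    (s : 'S_((\sum_(i < r) l i) + m))
    (alpha lambda : R),
  let n : nat := (\sum_(i < r) l i)%N in
  let nR : R := n%:R in
  let mR : R := m%:R in
  let rR : R := r%:R in
  let nm : R := (nmin l)%:R in
  let p := pminus B in
  let q := qplus B in
  let delta := p - q in
  gsbm P B K Z W ->
  0 < delta ->
  3 * mR <= alpha ->
  q + delta / 4 < lambda < p - delta / 4 ->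
  C * (ln nR / nm) <= p ->
  C * (Num.sqrt (p * ln nR / nm) + alpha / nm
       + Num.sqrt (nR * q * ln nR) / nm
       + mR * Num.sqrt rR / nm
       + (* equals 0 when m = 0, even if alpha = 0, since x / 0 = 0 *)
         nR * mR * p / ((alpha - 2 * mR) * nm)) < delta ->
  mR < nm / (2 * rR + 4) ->
  ((1 - 1 / nR - 2 * rR / nR ^+ 2 - c * rR / nm ^+ 4)%:E <=
   P [set w | forall (X : 'M[R]_(n + m)) (y : 'I_(n + m) -> 'cV[R]_(n + m))
                (f : 'I_(n + m) -> 'I_r),
        sdp_solution
          (sdp_cost alpha lambda (gsbm_adjacency R s (K w) (Z w) (W w))) X ->
        normalized_columns X y ->
        kmeans_solution y f ->
        (misclassification_rate R n (gsbm_label s) f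
           <= (2 * rR + 3) * mR / nR)%R])%E.
Proof.
(* C = 2^24 dominates every numerical constant of the concentration and certificate steps. The
   failure probability obtained is 1 / n, so the other two error terms are slack and any positive c
   would serve. *)
pose C : R := 64 * 64 * (64 * 64); exists C, 1.
have C0 : 0 < C by rewrite /C !mulr_gt0.
do 2!split=> //; move: C0; have : 64 * 64 * (64 * 64) <= C by [].
move: C => C hC C0.
move=> d T P r m l B K Z W s alpha lambda n nR mR rR nm p q delta.
move=> [r2 l1 sB B01 mK mZ mW sK dK sW dW law ind] d0 am /andP[lam1 lam2] hp hd mnm.
have C1 : 1 <= C by move: hC; clear; lra.
pose kap : 'I_n -> 'I_r := fun i => tagnat.sig1 i.
have lk k : block_size kap k = (l k)%:R :> R by rewrite /block_size card_sig1.
have rn : (r <= n)%N.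
  by rewrite -[r]card_ord -sum1_card; apply: leq_sum.
have n2 : (2 <= n)%N by exact: leq_trans rn.
have L0 := @half_le_ln_nat R _ n2.
have nm0 : (0 < nmin l)%N by apply: nmin_gt0 => //; exact: leq_trans n2.
have nmR0 : 0 < nm by rewrite ltr0n.
have nR0 : 0 < nR by rewrite ltr0n; exact: ltn_trans n2.
have nml k : nm <= block_size kap k by rewrite lk ler_nat nmin_le.
have l0 k : (0 : R) < block_size kap k by exact: lt_le_trans (nml k).
have Bp k : p <= B k k by exact: bigmin_le.
have Bq k k' : k != k' -> B k k' <= q by exact: qplus_ge.
have q0 : 0 <= q by exact: bigmax_ge_id.
have k0 : 'I_r by exact: (Ordinal (ltnW r2)).
have p1 : p <= 1 by apply: (le_trans (Bp k0)); case/andP: (B01 k0 k0).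
have p0 : 0 <= p by move: d0 q0; rewrite /delta; clear; lra.
have m0 : 0 <= mR by rewrite ler0n.
have r0 : 0 <= rR by rewrite ler0n.
have L0' : 0 <= ln nR by move: L0; clear; lra.
have [b1 b2 b3 [b4 b5] [b6 b7]] :=
  separation_bounds C1 nmR0 (ltW nR0) m0 r0 p0 q0 L0' d0 am hp hd.
have dp : delta <= p by rewrite /delta; move: q0; clear; lra.
have lam0 : 0 <= lambda by move: lam1 q0 d0; clear; lra.
have gk k : delta / 4 <= B k k - lambda.
  by have := Bp k; move: lam2; clear; lra.
have gk0 k : 0 < B k k - lambda by have := gk k; move: d0; clear; lra.
have qp : q <= p by move: d0; rewrite /delta; clear; lra.
have C2 x : 0 <= x -> 64 * 64 * (64 * 64) * x <= C ^+ 2 * x.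
  move=> x0; apply: ler_wpM2r => //; apply: (le_trans hC).
  by rewrite expr2 ler_peMl // ltW.
have CL : 64 * 64 * (64 * 64) * ln nR <= C * ln nR by apply: ler_wpM2r.
have F1 k : 32 * 64 * (32 * 64 * (B k k * ln nR)) <=
  (B k k - lambda) ^+ 2 * block_size kap k.
  exact: (gap_bounds hC nmR0 (nml k) p0 L0' d0 (Bp k) lam2 b1 b6).
have F2 k : 32 * 64 * (32 * 64 * (p * ln nR)) <= delta ^+ 2 * block_size kap k.
  have := C2 _ (mulr_ge0 p0 L0'); have := mulr_ge0 p0 L0'.
  have : delta ^+ 2 * nm <= delta ^+ 2 * block_size kap k by rewrite ler_pM2l ?exprn_gt0.
  by move: b1; clear; lra.
have gl k : delta / 4 * nm <= (B k k - lambda) * block_size kap k.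
  by apply: ler_pM => //; move: d0; clear; lra.
have F3 k : 32 * 64 * (4 * ln nR) <= (B k k - lambda) * block_size kap k.
  by have := gl k; move: CL b7 L0'; clear; lra.
have F4 : 32 * 64 * (32 * 64 * (q * nR * ln nR)) <= (delta * nm) ^+ 2.
  have x0 : 0 <= nR * q * ln nR by rewrite !mulr_ge0 // ltW.
  by have := C2 _ x0; move: x0 b3; clear; rewrite [q * nR]mulrC; lra.
have F5 : 32 * 64 * (4 * ln nR) <= delta * nm by move: CL b7 L0'; clear; lra.
have conc := @edge_noise_concentration R n r kap B lambda delta nm p q n2 rn sB B01
  d0 dp q0 qp l0 nmR0 lam0 gk0 Bq F1 F2 F3 F4 F5.
pose Xb := fun (e : edge n) w => K w (val e).1 (val e).2.
have mXb e : measurable_fun [set: T] (Xb e) by exact: mK.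
have law' e : P [set w | Xb e w = true] = (edge_prob kap B e)%:E by exact: law (valP e).
pose good (b : {ffun edge n -> bool}) :=
  (forall i k, `|(edge_noise kap B b *m indmx kap) i k| <=
       (if kap i == k then B k k - lambda else delta) / 16 * block_size kap k) /\
  (forall u, quad (edge_noise kap B b) u <=
       \sum_i ((B (kap i) (kap i) - lambda) / 16 * block_size kap (kap i)
         + delta * nm / 16) * u i 0 ^+ 2).
have mG : measurable [set w | good (bits Xb w)] by exact: measurable_bits_pred.
have PG : ((1 - nR^-1)%:E <= P [set w | good (bits Xb w)])%E.
  have := probability_bits_le (fun b => ~ good b) ind mXb law'.
  rewrite (_ : [set w | ~ good _] = ~` [set w | good (bits Xb w)]) //.
  rewrite probability_setC // => h.
  have {}h : (1 - P [set w | good (bits Xb w)] <= (nR^-1)%:E)%E.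
    by apply: (le_trans h); rewrite lee_fin; exact: conc.
  move: h; rewrite -(fineK (fin_num_measure P _ mG)) -EFinB !lee_fin.
  by clear; lra.
apply: (le_trans _ (le_trans PG _)).
  rewrite lee_fin !mul1r -!addrA lerD2l -[leRHS]addr0 lerD2l.
  have x1 : 0 <= 2 * rR / nR ^+ 2 by rewrite divr_ge0 ?mulr_ge0 // exprn_ge0 // ltW.
  have x2 : 0 <= rR / nm ^+ 4 by rewrite divr_ge0 // exprn_ge0 // ltW.
  by move: x1 x2; clear; lra.
apply: le_measure; rewrite ?inE //.
  pose M w := block_mx (K w) (Z w) (Z w)^T (W w).
  have mM : random_boolmx M.
    move=> i j; rewrite /M.
    case: (split_ordP i) => i' ->; case: (split_ordP j) => j' ->.
    - by under eq_fun do rewrite block_mxEul; exact: mK.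
    - by under eq_fun do rewrite block_mxEur; exact: mZ.
    - by under eq_fun do rewrite block_mxEdl mxE; exact: mZ.
    - by under eq_fun do rewrite block_mxEdr; exact: mW.
  exact: (measurable_boolmx (fun A => forall (X : 'M[R]_(n + m)) (y : 'I_(n + m) ->
    'cV[R]_(n + m))
                (f : 'I_(n + m) -> 'I_r),
        sdp_solution
          (sdp_cost alpha lambda (perm_mx s *m map_mx (fun b : bool => b%:R) A *m
            (perm_mx s)^T)) X ->
        normalized_columns X y ->
        kmeans_solution y f ->
        (misclassification_rate R n (gsbm_label s) f
           <= (2 * rR + 3) * mR / nR)%R) mM).
(* The event [good] involves [K] alone. From here on the argument is deterministic, which allows [Z]
   and [W] to depend on [K] in any way. *)
move=> w /= gw X y f solX ny ks.
have fX : sdp_feasible X by case: solX.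
apply: (misclassification_rate_blocks r2 fX _ mnm ny ks) => {y f ny ks}.
move: solX; rewrite /gsbm_adjacency -/(relabel s _) sdp_cost_relabel =>
  /sdp_solution_relabel.
rewrite map_block_mx -map_trmx.
set A11 := map_mx _ (K w); set A12 := map_mx _ (Z w); set A22 := map_mx _ (W w).
have b01 (b : bool) : (0 : R) <= b%:R <= 1 by case: b; rewrite ?lexx ?ler01.
have EN : edge_noise kap B (bits Xb w) =
    A11 - \matrix_(i, a) (if i == a then 0 else B (kap i) (kap a)).
  exact: edge_noise_bits sB (sK w) (dK w).
have [+ +] := gw; rewrite EN => gr gq solX i a.
have al0 : 0 <= alpha by move: am m0; clear; lra.
have Ca : 64 * 64 * (64 * 64) * alpha <= C * alpha by apply: ler_wpM2r.
have rnm : rR * nm <= nR by rewrite -natrM ler_nat muln_nmin_le.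
have mp : mR <= p * nm.
  have : delta * nm <= p * nm by rewrite ler_pM2r.
  by move: am b2 Ca m0; clear; lra.
have sr0 : 0 <= mR * Num.sqrt rR by rewrite mulr_ge0 ?sqrtr_ge0.
have dn0 : 0 <= delta * nm by rewrite mulr_ge0 // ltW.
(* The value 2 p n for [a0] works since lambda <= p and, by [mp], r m <= p r nm <= p n. It turns
   [m * a0 / (alpha - m)] into at most twice the last term of the separation hypothesis, cleared of
   its factor nm. *)
apply: (@sdp_inlier_block R n m r kap A11 A12 A22 B alpha lambda delta nm (2 * p * nR) _
  nmR0 _ nml _ _ _ _ _ _ am d0 sB _ gk _ gr gq _ _ _ _ solX).
- apply: (le_trans (ltW mnm)); rewrite ler_pdivrMr.
    by rewrite ler_peMr ?(ltW nmR0) //; move: r0; clear; lra.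
  by move: r0; clear; lra.
- by rewrite /A11 map_trmx sK.
- by move=> i' j; rewrite mxE b01.
- by rewrite /A22 map_trmx sW.
- by move=> j; rewrite mxE dW.
- by move=> j j'; rewrite mxE b01.
- by rewrite lam0 /=; move: lam2 p1 d0; clear; lra.
- by move=> k; case/andP: (B01 k k).
- by move=> k k' /Bq; move: lam1; clear; lra.
- by move: CL b7 L0; clear; lra.
- by move: Ca b2 al0; clear; lra.
- have e1 : lambda * nR <= p * nR.
    by apply: ler_wpM2r; [exact: ltW|move: lam2 d0; clear; lra].
  have e2 : rR * mR <= rR * (p * nm) by apply: ler_wpM2l.
  have e3 : p * (rR * nm) <= p * nR by apply: ler_wpM2l.
  by move: e1 e2 e3; clear; lra.
(* For m = 0 the left side is 0 even if alpha = 0; otherwise alpha >= 3 m makes both denominators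
   positive. *)
- have [m00|mpos] := posnP m.
    rewrite (_ : m%:R = 0) ?m00 // mul0r divr_ge0 //.
  have mR0 : 0 < mR by rewrite ltr0n.
  have a1 : 0 < alpha - 2 * mR by move: am mR0; clear; lra.
  have a3 : 0 < alpha - mR by move: am mR0; clear; lra.
  set t := nR * mR * p / (alpha - 2 * mR) in b5.
  have t0 : 0 <= t by rewrite divr_ge0 ?mulr_ge0 // ltW.
  have e1 : m%:R * (2 * p * nR / (alpha - m%:R)) <= 2 * t.
    rewrite mulrA ler_pdivrMr //.
    have -> : m%:R * (2 * p * nR) = 2 * (t * (alpha - 2 * mR)).
      by rewrite /t divfK ?gt_eqF // /mR; ring.
    rewrite -[leRHS]mulrA; apply: ler_wpM2l => //; apply: ler_wpM2l => //.
    by move: mR0; rewrite /mR; clear; lra.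
  have e2 : 64 * 64 * (64 * 64) * t <= C * t by apply: ler_wpM2r.
  have e3 : 64 * 64 * (64 * 64) * (mR * Num.sqrt rR) <= C * (mR * Num.sqrt rR).
    by apply: ler_wpM2r.
  rewrite mulrDr; move: e1 e2 e3 b4 b5 t0 sr0; rewrite /mR /rR; clear; lra.
Qed.
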